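(* Let $u$ be a solution of $u_t=(\mathcal L(u_x))_x$ in $I_T$ with associated selection $\Omega$, and let $t>0$ be a typical time, i.e. $u_t(\cdot,t),\Omega_x(\cdot,t)\in L^2(I)$. Let $x_0\in I$ be a point at which the one-sided derivatives $u_x^-(x_0,t)$ and $u_x^+(x_0,t)$ exist. If $u_x^-(x_0,t)<u_x^+(x_0,t)$, then $$(u_x^-(x_0,t),u_x^+(x_0,t))\cap\{-1,+1\}=\emptyset,$$ and if $u_x^+(x_0,t)<u_x^-(x_0,t)$, then $$(u_x^+(x_0,t),u_x^-(x_0,t))\cap\{-1,+1\}=\emptyset .$$
   Context: Fix reals $a<b$, $T>0$, $I=(a,b)$, $I_T=I\times(0,T)$. $\operatorname{sgn}$ is the multivalued sign graph ($1$ for $p>0$, $-1$ for $p<0$, $[-1,1]$ at $p=0$), $\mathcal L(p)=\operatorname{sgn}(p+1)+\operatorname{sgn}(p-1)$, $W(p)=|p+1|+|p-1|$. For $v\in BV(I)$, $\int_I W(Dv):=|D(v+x)|(I)+|D(v-x)|(I)$. $\gamma$ denotes the trace (one-sided limit from inside $I$ at an endpoint). Solution: $u\in L^\infty(0,T;BV(I))$ with $u_t\in L^2(0,T;L^2(I))$ is a solution of $u_t=(\mathcal L(u_x))_x$ if there is $\Omega\in L^2(0,T;W^{1,2}(I))$ (the associated selection) such that for a.e. $t$: (i) $\int_I u_t\varphi\,dx=-\int_I\Omega\varphi_x\,dx$ for all $\varphi\in C_0^\infty(I)$; (ii) $\Omega(\cdot,t)$ is a selection of $\mathcal L\circ u_x(\cdot,t)$,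 understood in the subdifferential sense: $\int_I W(Dv)\ge\int_I W(Du(\cdot,t))+\int_I\Omega(\cdot,t)\,d(Dv-Du(\cdot,t))$ for all $v\in BV(I)$. Solutions are taken with one of the following boundary conditions (for a.e. $t>0$). Neumann: $\gamma\Omega(a)=\gamma\Omega(b)=0$. Dirichlet data $A,B\in\mathbb R$: at $x=a$ either $\gamma u(a)=A$, or $\gamma u(a)>A$ and $\gamma\Omega(a)=2$, or $\gamma u(a)<A$ and $\gamma\Omega(a)=-2$; at $x=b$ either $\gamma u(b)=B$, or $\gamma u(b)>B$ and $\gamma\Omega(b)=-2$, or $\gamma u(b)<B$ and $\gamma\Omega(b)=2$. Periodic: the problem is posed on the circle obtained by identifying $a$ and $b$. Typical times: $t>0$ is typical if $\int_I|u_t(x,t)|^2dx<\infty$ and $\int_I|\Omega_x(x,t)|^2dx<\infty$; typical times are taken in the full-measure set of $t$ at which $u(\cdot,t)\in BV(I)$ and the a.e.-in-time relations defining a solution hold. One-sided derivatives: $u_x^\pm(x_0,t)=\lim_{x\to x_0^\pm}\frac{u(x,t)-u(x_0^\pm,t)}{x-x_0}$, where $u(x_0^\pm,t)$ are the one-sided limits of the $BV$ function $u(\cdot,t)$ at $x_0$. *)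

(* Defs.v *)
From HB Require Import structures.
From mathcomp Require Import all_boot all_order all_algebra.
From mathcomp Require Import all_classical all_reals all_analysis.
Set Implicit Arguments.
Unset Strict Implicit.
Unset Printing Implicit Defensive.
Import Order.TTheory GRing.Theory Num.Theory.
Import numFieldNormedType.Exports.
Local Open Scope ring_scope.
Local Open Scope classical_set_scope.

Section SignedMeasures.
Context (R : realType).
Implicit Types (nu : {charge set R -> \bar R}).

Definition hahn_pos nu : set R := projT1 (cid (Hahn_decomposition nu)).

Definition hahn_neg nu : set R :=
  projT1 (cid (projT2 (cid (Hahn_decomposition nu)))).

Lemma hahn_posnegP nu : hahn_decomposition nu (hahn_pos nu) (hahn_neg nu).
Proof. exact: projT2 (cid (projT2 (cid (Hahn_decomposition nu)))). Qed.

Definition total_var nu (D : set R) : \bar R :=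
  charge_variation (hahn_posnegP nu) D.

Definition charge_integral nu (D : set R) (f : R -> R) : R :=
  \int[jordan_pos (hahn_posnegP nu)]_(x in D) f x
  - \int[jordan_neg (hahn_posnegP nu)]_(x in D) f x.

End SignedMeasures.

Inductive bdry_cond (R : realType) : Type :=
| Neumann
| Dirichlet of R & R
| Periodic.
Arguments Neumann {R}.
Arguments Periodic {R}.

Section TotalVariationFlow.
Context (R : realType).
Local Notation mu := (@lebesgue_measure R).
Implicit Types (bc : bdry_cond R) (a b c : R) (v f g phi : R -> R)
  (nu : {charge set R -> \bar R}).

Definition smooth phi : Prop :=
  forall n x, derivable (derive1n n phi) x 1.

Definition Ccinfty a b phi : Prop :=
  smooth phi /\
  exists c d : R, [/\ a < c, d < b & forall x, phi x != 0 -> c <= x <= d].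

(* Smooth functions on the circle are the smooth (b - a)-periodic functions. *)
Definition test bc a b phi : Prop :=
  if bc is Periodic then smooth phi /\ (forall x, phi (x + (b - a)) = phi x)
  else Ccinfty a b phi.

(* The spatial domain as a set of points. The circle is represented by [a, b[,
   the point a standing for the two identified endpoints: a measure on the
   circle may have an atom there. *)
Definition domain bc a b : set R :=
  if bc is Periodic then `[a, b[ else `]a, b[.

(* nu is the distributional derivative Dv on the domain (nu is only ever used
   on subsets of the domain). *)
Definition is_D bc a b v nu : Prop :=
  forall phi, test bc a b phi ->
    \int[mu]_(x in `]a, b[) (v x * derive1 phi x)
    = - charge_integral nu (domain bc a b) phi.

(* nu = D(v + c x). On the circle, where x is not a function, this is to be
   read as the measure Dv + c dx: no atom arises at the identified endpoints. *)
Definition is_D_tilt bc a b v c nu : Prop :=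
  if bc is Periodic then
    forall phi, test bc a b phi ->
      \int[mu]_(x in `]a, b[) (v x * derive1 phi x)
        - c * \int[mu]_(x in `]a, b[) phi x
      = - charge_integral nu (domain bc a b) phi
  else is_D bc a b (fun x => v x + c * x) nu.

Definition BV bc a b v : Prop :=
  mu.-integrable `]a, b[ (EFin \o v) /\ exists nu, is_D bc a b v nu.

(* w = \int W(Dv) = |D(v + x)| + |D(v - x)| *)
Definition is_W bc a b v (w : \bar R) : Prop :=
  exists nup num : {charge set R -> \bar R},
    [/\ is_D_tilt bc a b v 1 nup, is_D_tilt bc a b v (-1) num &
        w = (total_var nup (domain bc a b) + total_var num (domain bc a b))%E].

Definition L2 a b f : Prop :=
  measurable_fun `]a, b[ f /\
  (\int[mu]_(x in `]a, b[) ((f x) ^+ 2)%:E < +oo)%E.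

Definition is_weak_deriv bc a b f g : Prop :=
  forall phi, test bc a b phi ->
    \int[mu]_(x in `]a, b[) (f x * derive1 phi x)
    = - \int[mu]_(x in `]a, b[) (g x * phi x).

Definition ae_eq_on a b f g : Prop :=
  {ae mu, forall x, a < x < b -> f x = g x}.

(* Elements of BV(I) and W^{1,2}(I) are classes of functions modulo equality
   almost everywhere: one-sided limits are those of a representative for which
   they exist. The values do not depend on the representative. *)
Definition right_lim a b v (x0 l : R) : Prop :=
  exists w : R -> R, ae_eq_on a b w v /\ w x @[x --> x0^'+] --> l.

Definition left_lim a b v (x0 l : R) : Prop :=
  exists w : R -> R, ae_eq_on a b w v /\ w x @[x --> x0^'-] --> l.

Definition right_deriv a b v (x0 p : R) : Prop :=
  exists (w : R -> R) (l : R),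
    [/\ ae_eq_on a b w v, w x @[x --> x0^'+] --> l &
        (w x - l) / (x - x0) @[x --> x0^'+] --> p].

Definition left_deriv a b v (x0 p : R) : Prop :=
  exists (w : R -> R) (l : R),
    [/\ ae_eq_on a b w v, w x @[x --> x0^'-] --> l &
        (w x - l) / (x - x0) @[x --> x0^'-] --> p].

(* om is a selection of L o v_x in the subdifferential sense; since Dv may have
   a singular part, om is integrated through its continuous representative. *)
Definition is_selection bc a b v (om : R -> R) : Prop :=
  exists omc : R -> R,
    [/\ {within `[a, b], continuous omc}, ae_eq_on a b omc om &
        forall (z : R -> R) (Dv Dz : {charge set R -> \bar R}) (Wv Wz : \bar R),
          BV bc a b z ->
          is_D bc a b v Dv -> is_D bc a b z Dz ->
          is_W bc a b v Wv -> is_W bc a b z Wz ->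
          (Wz >= Wv + (charge_integral (cadd Dz (cscale (-1) Dv))
                         (domain bc a b) omc)%:E)%E].

(* Nothing to prescribe in the periodic case: it is encoded in the test
   functions and in the domain. *)
Definition bdry_holds bc a b v (om : R -> R) : Prop :=
  match bc with
  | Neumann => right_lim a b om a 0 /\ left_lim a b om b 0
  | Dirichlet A B =>
      exists va vb oma omb : R,
        [/\ right_lim a b v a va, left_lim a b v b vb,
            right_lim a b om a oma & left_lim a b om b omb] /\
        [/\ va = A \/ (va > A /\ oma = 2) \/ (va < A /\ oma = -2) &
            vb = B \/ (vb > B /\ omb = -2) \/ (vb < B /\ omb = 2)]
  | Periodic => True
  end.

(* In functions of time and space such as u : R -> R -> R, time comes first.
   Elements of L^p(0, T; X) are encoded by jointly measurable representatives.
   For X = BV, which is not separable, this is weak measurability in time. *)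

Definition jointly_measurable a b (T : R) (u : R -> R -> R) : Prop :=
  measurable_fun (`]0, T[ `*` `]a, b[)
    (fun p : R * R => u p.1 p.2).

Definition L2L2 a b (T : R) (f : R -> R -> R) : Prop :=
  jointly_measurable a b T f /\
  (\int[mu]_(t in `]0%R, T[) \int[mu]_(x in `]a, b[) ((f t x) ^+ 2)%:E
     < +oo)%E.

Definition L2W12 bc a b (T : R) (f : R -> R -> R) : Prop :=
  L2L2 a b T f /\
  exists fx : R -> R -> R, L2L2 a b T fx /\
    {ae mu, forall t, 0 < t < T -> is_weak_deriv bc a b (f t) (fx t)}.

Definition LooBV bc a b (T : R) (u : R -> R -> R) : Prop :=
  jointly_measurable a b T u /\
  exists M : R, {ae mu, forall t, 0 < t < T ->
    BV bc a b (u t) /\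
    exists Du, is_D bc a b (u t) Du /\
      (\int[mu]_(x in `]a, b[) `|u t x|%:E + total_var Du (domain bc a b)
         <= M%:E)%E}.

(* ut is the weak time derivative of u: (0, T) -> L^1(I). *)
Definition is_weak_time_deriv a b (T : R) (u ut : R -> R -> R) : Prop :=
  forall eta, Ccinfty 0 T eta ->
    {ae mu, forall x, a < x < b ->
      \int[mu]_(t in `]0, T[) (u t x * derive1 eta t)
      = - \int[mu]_(t in `]0, T[) (ut t x * eta t)}.

Definition relations_at bc a b (v vt om : R -> R) : Prop :=
  [/\ BV bc a b v,
      forall phi, test bc a b phi ->
        \int[mu]_(x in `]a, b[) (vt x * phi x)
        = - \int[mu]_(x in `]a, b[) (om x * derive1 phi x),
      is_selection bc a b v om &
      bdry_holds bc a b v om].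

(* ut and Om are fixed representatives of u_t and of the associated selection. *)
Definition is_solution bc a b (T : R) (u ut Om : R -> R -> R) : Prop :=
  [/\ LooBV bc a b T u,
      L2L2 a b T ut /\ is_weak_time_deriv a b T u ut,
      L2W12 bc a b T Om &
      {ae mu, forall t, 0 < t < T ->
        relations_at bc a b (u t) (ut t) (Om t)}].

Definition typical_time bc a b (T : R) (u ut Om : R -> R -> R) (t : R) : Prop :=
  [/\ 0 < t < T,
      relations_at bc a b (u t) (ut t) (Om t),
      L2 a b (ut t) &
      L2 a b (Om t) /\
      exists omx : R -> R, L2 a b omx /\ is_weak_deriv bc a b (Om t) omx].

End TotalVariationFlow.

(* Main.v *)
Require Import Defs.
From HB Require Import structures.
From mathcomp Require Import all_boot all_order all_algebra.
From mathcomp Require Import all_classical all_reals all_analysis.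
From mathcomp Require Import measurable_realfun ring lra.
Set Implicit Arguments.
Unset Strict Implicit.
Unset Printing Implicit Defensive.
Import Order.TTheory GRing.Theory Num.Theory.
Import numFieldNormedType.Exports.
Local Open Scope ring_scope.
Local Open Scope classical_set_scope.

(** Let [c] be [1] or [-1] and [kappa = Du - c dx]. If the two one-sided slopes
    of [u] at [x0] lie strictly on either side of [c], then [kappa] has both a
    positive and a negative part in every neighbourhood [K] of [x0]: test [kappa]
    with rescaled bump functions supported on one side of [x0]. Let [sigma] be
    [s kappa^-] minus [r kappa^+] on [K], with [0 <= r, s <= 1] chosen so that both
    terms have the same mass [m > 0]. Since [sigma] has total mass [0], it is [Dh]
    for some [h] vanishing outside [K]. Passing from [u] to [u + h] lowers
    [|kappa|] by [2 m] and does not increase the total variation of the other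
    measure [Du + c dx], while the duality term [int Om dsigma] is at least [- m]
    if [K] is so small that [Om] stays within [1/2] of [Om x0] on [K]. This
    contradicts the subdifferential inequality. As [sigma] has zero mass and is
    supported near [x0], the argument does not see the boundary condition. *)

(** * Arithmetic of finite extended reals *)

Section ExtendedReals.
Context (R : realType).
Implicit Types x y z t : \bar R.
Local Open Scope ereal_scope.

Lemma sube_eq_adde x y z t : x \is a fin_num -> y \is a fin_num ->
  z \is a fin_num -> t \is a fin_num -> x - y = z - t -> x + t = y + z.
Proof.
move: x y z t => [x| |] [y| |] [z| |] [t| |]// _ _ _ _.
by rewrite -!EFinB -!EFinD => -[h]; congr EFin; lra.
Qed.

Lemma subeACA x y z t : x \is a fin_num -> y \is a fin_num ->
  z \is a fin_num -> t \is a fin_num -> x - y + (z - t) = x + z - (y + t).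
Proof.
move: x y z t => [x| |] [y| |] [z| |] [t| |]// _ _ _ _.
by rewrite -!EFinB -!EFinD; congr EFin; lra.
Qed.

Lemma muleNsube (k : R) x y : x \is a fin_num -> y \is a fin_num ->
  k%:E * (x - y) = (- k)%:E * y - (- k)%:E * x.
Proof.
move: x y => [x| |] [y| |]// _ _.
by rewrite -?EFinB -?EFinM -?EFinB; congr EFin; lra.
Qed.

End ExtendedReals.

(** * Integration against finite measures *)

Section FiniteMeasures.
Context d (T : measurableType d) (R : realType).
Implicit Types (m : {finite_measure set T -> \bar R}) (D : set T) (f : T -> R).

Lemma bounded_integrable m D f (M : R) : measurable D -> measurable_fun D f ->
  (forall x, D x -> `|f x| <= M) -> m.-integrable D (EFin \o f).
Proof.
move=> mD mf fM; apply: measurable_bounded_integrable => //.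
  by rewrite -ge0_fin_numE//; exact: fin_num_measure.
exists M; split; first exact: num_real.
by move=> y /ltW My x Dx; exact: le_trans (fM x Dx) My.
Qed.

Lemma Rintegral_measure_add (m1 m2 : {measure set T -> \bar R}) D f :
  measurable D ->
  m1.-integrable D (EFin \o f) -> m2.-integrable D (EFin \o f) ->
  \int[measure_add m1 m2]_(x in D) f x =
  \int[m1]_(x in D) f x + \int[m2]_(x in D) f x.
Proof.
move=> mD f1 f2; rewrite /Rintegral integral_measure_add//.
by rewrite fineD//; exact: integrable_fin_num.
Qed.

Lemma Rintegral_mscale (k : {nonneg R}) (m : {measure set T -> \bar R}) D f :
  measurable D -> m.-integrable D (EFin \o f) ->
  \int[mscale k m]_(x in D) f x = k%:num * \int[m]_(x in D) f x.
Proof.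
move=> mD fi; rewrite /Rintegral.
have mf := measurable_int _ fi.
rewrite integralE ge0_integral_mscale//; last exact: measurable_funepos.
rewrite ge0_integral_mscale//; last exact: measurable_funeneg.
have fp := integral_funepos_lt_pinfty mD fi.
have fn := integral_funeneg_lt_pinfty mD fi.
rewrite -muleBr//; last first.
  apply: fin_num_adde_defr; rewrite ge0_fin_numE//.
  exact: integral_ge0.
by rewrite -integralE fineM//; exact: integrable_fin_num.
Qed.

Lemma Rintegral_eq_measure (m1 m2 : {measure set T -> \bar R}) D f :
  measurable D -> (forall E, measurable E -> m1 E = m2 E) ->
  \int[m1]_(x in D) f x = \int[m2]_(x in D) f x.
Proof.
move=> mD m12; rewrite /Rintegral; congr fine.
by apply: eq_measure_integral => E mE _; exact: m12.
Qed.

Lemma Rintegral_concentrated m D (K : set T) f (M : R) : measurable D -> measurable K ->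
  K `<=` D -> m (~` K) = 0%E -> measurable_fun D f ->
  (forall x, D x -> `|f x| <= M) ->
  \int[m]_(x in D) f x = \int[m]_(x in K) f x.
Proof.
move=> mD mK KD m0 mf fM; rewrite /Rintegral.
have mKC : measurable (~` K) by exact: measurableC.
rewrite (negligible_integral mKC mD _ m0)//; last exact: bounded_integrable fM.
by rewrite setDE setCK (setIidr KD).
Qed.

End FiniteMeasures.

Section FiniteMeasureAdd.
Context d (T : measurableType d) (R : realType).
Variables m1 m2 : {finite_measure set T -> \bar R}.

(** The finite-measure instance lets sums of Jordan parts serve as [m1] and [m2] in
    [charge_integralE]. *)
Let measure_add_fin : fin_num_fun (measure_add m1 m2).
Proof. by move=> E mE; rewrite measure_addE fin_numD !fin_num_measure. Qed.

HB.instance Definition _ := Measure.on (measure_add m1 m2).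
HB.instance Definition _ :=
  Measure_isFinite.Build _ _ _ (measure_add m1 m2) measure_add_fin.

Lemma finite_measure_addE E : measure_add m1 m2 E = (m1 E + m2 E)%E.
Proof. exact: measure_addE. Qed.

End FiniteMeasureAdd.

(** * Integrals against signed measures, and their total variation under perturbation *)

Section Charges.
Context (R : realType).
Implicit Types (nu sigma : {charge set R -> \bar R}) (D E : set R) (f : R -> R)
  (m : {finite_measure set R -> \bar R}).

Local Notation pos nu := (jordan_pos (hahn_posnegP nu)).
Local Notation neg nu := (jordan_neg (hahn_posnegP nu)).

Lemma measurable_hahn_pos nu : measurable (hahn_pos nu).
Proof. by have [[]] := hahn_posnegP nu. Qed.

Lemma measurable_hahn_neg nu : measurable (hahn_neg nu).
Proof. by have [_ []] := hahn_posnegP nu. Qed.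

Lemma jordan_posI nu E : measurable E -> pos nu E = nu (E `&` hahn_pos nu).
Proof. by move=> mE; rewrite jordan_posE cjordan_posE /crestr0 mem_set. Qed.

Lemma jordan_negI nu E : measurable E -> neg nu E = (- nu (E `&` hahn_neg nu))%E.
Proof. by move=> mE; rewrite jordan_negE cjordan_negE /crestr0 mem_set. Qed.

Lemma jordan_diff nu E : measurable E -> nu E = (pos nu E - neg nu E)%E.
Proof.
move=> mE; rewrite (jordan_decomp (hahn_posnegP nu) mE) /cadd/=; congr (_ + _)%E.
by rewrite cscaleN1. Qed.

(** The integral does not depend on how the charge is split: [pos nu - neg nu = m1 - m2] means that
    the nonnegative measures [pos nu + m2] and [neg nu + m1] coincide, and integrals against these
    are additive. Linearity in the charge follows, although Jordan parts are not additive. *)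
Lemma charge_integralE nu m1 m2 D f (M : R) :
  measurable D -> measurable_fun D f -> (forall x, D x -> `|f x| <= M) ->
  (forall E, measurable E -> nu E = (m1 E - m2 E)%E) ->
  charge_integral nu D f = \int[m1]_(x in D) f x - \int[m2]_(x in D) f x.
Proof.
move=> mD mf fM numm; rewrite /charge_integral.
have int m : m.-integrable D (EFin \o f) by exact: bounded_integrable fM.
have : \int[measure_add (pos nu) m2]_(x in D) f x =
       \int[measure_add (neg nu) m1]_(x in D) f x.
  apply: Rintegral_eq_measure => // E mE.
  rewrite [LHS]finite_measure_addE [RHS]finite_measure_addE.
  have := numm E mE; rewrite (jordan_diff nu mE).
  by apply: sube_eq_adde; exact: fin_num_measure.
rewrite !Rintegral_measure_add//; [|exact: int..].
lra.
Qed.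

Lemma charge_integral_cadd nu1 nu2 D f (M : R) :
  measurable D -> measurable_fun D f -> (forall x, D x -> `|f x| <= M) ->
  charge_integral (cadd nu1 nu2) D f =
  charge_integral nu1 D f + charge_integral nu2 D f.
Proof.
move=> mD mf fM.
have int (m : {finite_measure set R -> \bar R}) : m.-integrable D (EFin \o f).
  exact: bounded_integrable fM.
rewrite (@charge_integralE _ (measure_add (pos nu1) (pos nu2))
  (measure_add (neg nu1) (neg nu2)) _ _ M)//; last first.
  move=> E mE; transitivity (nu1 E + nu2 E)%E => //.
  rewrite (jordan_diff nu1 mE) (jordan_diff nu2 mE).
  transitivity (pos nu1 E + pos nu2 E - (neg nu1 E + neg nu2 E))%E.
    by apply: subeACA; exact: fin_num_measure.
  by congr (_ - _)%E; symmetry; exact: finite_measure_addE.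
rewrite !Rintegral_measure_add//; [|exact: int..].
by rewrite /charge_integral; lra.
Qed.

Lemma charge_integral_cscale (k : R) nu D f (M : R) :
  measurable D -> measurable_fun D f -> (forall x, D x -> `|f x| <= M) ->
  charge_integral (cscale k nu) D f = k * charge_integral nu D f.
Proof.
move=> mD mf fM.
have int (m : {finite_measure set R -> \bar R}) : m.-integrable D (EFin \o f).
  exact: bounded_integrable fM.
have [k0|k0] := leP 0 k.
  pose k' := NngNum k0.
  rewrite (@charge_integralE _ (mscale k' (pos nu)) (mscale k' (neg nu)) _ _ M)//.
    by rewrite !Rintegral_mscale//= -mulrBr.
  move=> E mE; transitivity (k%:E * nu E)%E => //.
  rewrite (jordan_diff nu mE) muleBr//.
  by apply: fin_num_adde_defr; exact: fin_num_measure.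
(* A negative factor exchanges the two Jordan parts, each then scaled by [- k]. *)
have k0' : 0 <= - k by lra.
pose k' := NngNum k0'.
rewrite (@charge_integralE _ (mscale k' (neg nu)) (mscale k' (pos nu)) _ _ M)//.
  by rewrite !Rintegral_mscale//= /charge_integral; lra.
move=> E mE; transitivity (k%:E * nu E)%E => //.
rewrite (jordan_diff nu mE).
by apply: muleNsube; exact: fin_num_measure.
Qed.

Lemma total_varE nu D : measurable D -> total_var nu D =
  (nu (D `&` hahn_pos nu) - nu (D `&` hahn_neg nu))%E.
Proof. by move=> mD; rewrite /total_var /charge_variation jordan_posI// jordan_negI. Qed.

Lemma total_var_fin nu D : measurable D -> total_var nu D \is a fin_num.
Proof.
by move=> mD; rewrite /total_var /charge_variation fin_numD !fin_num_measure.
Qed.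

Section Perturbation.
Variables (nu sigma : {charge set R -> \bar R})
  (m1 m2 : {finite_measure set R -> \bar R}) (D : set R).
Hypothesis mD : measurable D.
Hypothesis sigmaE : forall E, measurable E -> sigma E = (m2 E - m1 E)%E.

Let tv (nu : {charge set R -> \bar R}) := fine (total_var nu D).

(** The perturbed charge is [(pos nu - m1) - (neg nu - m2)]. A measure [m1] or [m2] lying below its
    Jordan part removes its mass from the variation; otherwise it adds at most its mass. The flags
    record which of the two dominations is assumed. *)
Let perturb (b1 b2 : bool) :
  (b1 -> forall E, measurable E -> (m1 E <= pos nu E)%E) ->
  (b2 -> forall E, measurable E -> (m2 E <= neg nu E)%E) ->
  b1 || b2 ->
  tv (cadd nu sigma) <= tv nu + (if b1 then - fine (m1 D) else fine (m1 D))
                             + (if b2 then - fine (m2 D) else fine (m2 D)).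
Proof.
move=> h1 h2 b12; set nu' := cadd nu sigma.
(* On the Hahn sets of the perturbed charge its variation is a difference of two values, so the
   claim becomes a linear inequality between the masses of [E1] and [E2]. *)
set E1 := D `&` hahn_pos nu'; set E2 := D `&` hahn_neg nu'.
have mE1 : measurable E1 by apply: measurableI => //; exact: measurable_hahn_pos.
have mE2 : measurable E2 by apply: measurableI => //; exact: measurable_hahn_neg.
have add (m : {finite_measure set R -> \bar R}) :
    fine (m D) = fine (m E1) + fine (m E2).
  rewrite -fineD ?fin_num_measure//; congr fine.
  have := charge_partition (charge_of_finite_measure m) mD
    (measurable_hahn_pos nu') (measurable_hahn_neg nu').
  have [_ _ PNT PN0] := hahn_posnegP nu'.
  exact.
have nu'E E : measurable E -> fine (nu' E) =
    fine (pos nu E) - fine (neg nu E) + (fine (m2 E) - fine (m1 E)).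
  move=> mE; rewrite /nu' /cadd/= sigmaE// (jordan_diff nu mE).
  by rewrite fineD ?fineB ?fin_numD ?fin_numN ?fin_num_measure.
have ge (m : {finite_measure set R -> \bar R}) E : measurable E -> 0 <= fine (m E).
  by move=> mE; rewrite fine_ge0.
have tv' : tv nu' = fine (nu' E1) - fine (nu' E2).
  by rewrite /tv total_varE// fineB// fin_num_measure.
have tvnu : tv nu = fine (pos nu D) + fine (neg nu D).
  by rewrite /tv /total_var /charge_variation fineD// fin_num_measure.
rewrite tv' !nu'E// tvnu !add.
have h1' : b1 -> forall E, measurable E -> fine (m1 E) <= fine (pos nu E).
  by move=> b E mE; rewrite fine_le ?fin_num_measure//; exact: h1.
have h2' : b2 -> forall E, measurable E -> fine (m2 E) <= fine (neg nu E).
  by move=> b E mE; rewrite fine_le ?fin_num_measure//; exact: h2.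
have := (ge m1 _ mE1, ge m1 _ mE2, ge m2 _ mE1, ge m2 _ mE2).
have := (ge (pos nu) _ mE1, ge (pos nu) _ mE2, ge (neg nu) _ mE1, ge (neg nu) _ mE2).
move=> [[[? ?] ?] ?] [[[? ?] ?] ?].
case: b1 b2 h1' h2' b12 {h1 h2} => -[]// h1 h2 _.
- have [? ?] := (h1 isT _ mE1, h1 isT _ mE2).
  have [? ?] := (h2 isT _ mE1, h2 isT _ mE2); lra.
- have [? ?] := (h1 isT _ mE1, h1 isT _ mE2); lra.
- have [? ?] := (h2 isT _ mE1, h2 isT _ mE2); lra.
Qed.

Lemma total_var_perturb_both :
  (forall E, measurable E -> (m1 E <= pos nu E)%E) ->
  (forall E, measurable E -> (m2 E <= neg nu E)%E) ->
  fine (total_var (cadd nu sigma) D) <=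
  fine (total_var nu D) - fine (m1 D) - fine (m2 D).
Proof. by move=> h1 h2; apply: (@perturb true true). Qed.

Lemma total_var_perturb_pos :
  (forall E, measurable E -> (m1 E <= pos nu E)%E) ->
  fine (total_var (cadd nu sigma) D) <=
  fine (total_var nu D) - fine (m1 D) + fine (m2 D).
Proof. by move=> h1; apply: (@perturb true false). Qed.

Lemma total_var_perturb_neg :
  (forall E, measurable E -> (m2 E <= neg nu E)%E) ->
  fine (total_var (cadd nu sigma) D) <=
  fine (total_var nu D) + fine (m1 D) - fine (m2 D).
Proof. by move=> h2; apply: (@perturb false true). Qed.

End Perturbation.

End Charges.

(** * Smooth functions built from exp(-1/q) *)

Section SmoothFunctions.
Context (R : realType).
Implicit Types (q P : {poly R}) (f g : R -> R).

(** The factors [P] and [q^-k] make this class stable under derivation, so that smoothness is an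
    induction on the order. *)
Definition flat q P k (x : R) : R :=
  if 0 < q.[x] then P.[x] * (q.[x])^-1 ^+ k * expR (- (q.[x])^-1) else 0.

(** This is [exp z >= z^(k+2) / (k+2)!] at [z = 1/y]. Two powers of [y] are kept: one absorbs the
    division by the increment in a difference quotient, the other tends to zero. *)
Lemma exprV_expR_le (y : R) k : 0 < y ->
  y^-1 ^+ k * expR (- y^-1) <= (k.+2)`!%:R * y ^+ 2.
Proof.
move=> y0; have yi0 : 0 < y^-1 by rewrite invr_gt0.
have f0 : 0 < (k.+2)`!%:R :> R by rewrite ltr0n fact_gt0.
have /(le_trans _) le1 := expR_ge1Dxn k.+1 (ltW yi0).
have {le1} : y^-1 ^+ k.+2 / (k.+2)`!%:R <= expR y^-1 by apply: le1; rewrite lerDr.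
rewrite ler_pdivrMr// => h.
rewrite expRN ler_pdivrMr ?expR_gt0//.
have -> : y^-1 ^+ k = y ^+ 2 * y^-1 ^+ k.+2.
  by rewrite -(addn2 k) exprD mulrCA -exprMn divff ?gt_eqF// expr1n mulr1.
by rewrite [leRHS]mulrAC [leRHS]mulrC ler_pM2l ?exprn_gt0// [leRHS]mulrC.
Qed.

Lemma flat_derive_identity (e p p' w w' : R) k : w != 0 ->
  p * w^-1 ^+ k * (e * (- (- w ^- 2 * w'))) +
  e * (p * (k%:R * w^-1 ^+ k.-1 * (- w ^- 2 * w')) + w^-1 ^+ k * p') =
  (p' * w ^+ 2 - k%:R * (p * w' * w) + p * w') * w^-1 ^+ k.+2 * e.
Proof.
(* The predecessor [k.-1] is [0] at [k = 0], where its term carries the factor [k%:R = 0]. *)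
move=> w0; case: k => [|k].
  by rewrite !expr0; field.
by rewrite !exprS /=; field.
Qed.

Lemma is_derive_flat_pos q P k x : 0 < q.[x] ->
  is_derive x 1 (flat q P k)
  (flat q (P^`() * q ^+ 2 - k%:R *: (P * q^`() * q) + P * q^`()) k.+2 x).
Proof.
move=> qx.
have qx0 : q.[x] != 0 by rewrite gt_eqF.
pose u := fun y : R => (q.[y])^-1.
have du : is_derive x 1 u (- q.[x] ^- 2 *: q^`().[x]).
  exact: is_deriveV.
have de : is_derive x 1 (expR \o (- u)) (expR (- u x) * (- (- q.[x] ^- 2 *: q^`().[x]))).
  by apply: is_derive1_comp.
have dk := is_deriveX k du.
have dP : is_derive x 1 (horner P) P^`().[x] by exact: is_derive_poly.
have dall := is_deriveM (is_deriveM dP dk) de.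
apply: (@near_eq_is_derive _ _ _ ((horner P * u ^+ k) * (expR \o (- u)))).
  near=> y; rewrite /flat ifT; last first.
    near: y; apply: (@cvgr_gt _ _ _ _ _ q.[x]) => //.
    exact: continuous_horner.
  by rewrite !fctE.
apply: is_derive_eq dall _.
rewrite /flat qx !(hornerD, hornerN, hornerM, hornerZ, horner_exp) !fctE.
exact: flat_derive_identity.
Unshelve. all: by end_near.
Qed.

(** With [y = q(x + h)], the difference quotient is dominated by a constant times [P y (y / h)],
    where [y] tends to [0] and [y / h] to [q'(x)]. The zero of [q] may have any order. *)
Lemma is_derive_flat0 q P k x : q.[x] = 0 -> is_derive x 1 (flat q P k) 0.
Proof.
move=> qx0.
suff h0 : h^-1 *: (flat q P k (h *: 1 + x) - flat q P k x) @[h --> 0^'] --> (0:R).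
  apply: DeriveDef; first by apply/cvg_ex; exists 0.
  exact/cvg_lim.
have -> : flat q P k x = 0 by rewrite /flat qx0 ltxx.
have dq : h^-1 *: (q.[h *: 1 + x] - q.[x]) @[h --> 0^'] --> q^`().[x].
  have : is_derive x 1 (horner q) q^`().[x] by exact: is_derive_poly.
  by case => dq <-; exact: dq.
have cx : (h *: 1 + x) @[h --> 0^'] --> x.
  have -> : (fun h : R => h *: 1 + x) = horner ('X + x%:P).
    by apply/funext => h; rewrite !hornerE /GRing.scale/= mulr1.
  have := @continuous_horner _ ('X + x%:P) 0.
  rewrite /continuous_at hornerD hornerX hornerC add0r.
  by apply: cvg_trans; apply: cvg_app; exact: cvg_within.
have cP : P.[h *: 1 + x] @[h --> 0^'] --> P.[x].
  by apply: (cvg_comp _ _ cx); exact: continuous_horner.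
have cq : q.[h *: 1 + x] @[h --> 0^'] --> q.[x].
  by apply: (cvg_comp _ _ cx); exact: continuous_horner.
rewrite qx0 in cq.
pose F h := P.[h *: 1 + x] * (k.+2)`!%:R * q.[h *: 1 + x] *
  (h^-1 *: (q.[h *: 1 + x] - q.[x])).
have cF : F h @[h --> 0^'] --> P.[x] * (k.+2)`!%:R * 0 * q^`().[x].
  exact: cvgM (cvgM (cvgM cP (cvg_cst _)) cq) dq.
rewrite mulr0 mul0r in cF.
have cF' : `|F h| @[h --> 0^'] --> (0:R).
  have := cvg_norm cF; rewrite normr0; exact.
apply/norm_cvg0P.
apply: (squeeze_cvgr _ (cvg_cst 0) cF').
near=> h; rewrite normr_ge0/= subr0.
have h0 : h != 0 by near: h; exact: nbhs_dnbhs_neq.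
rewrite /F qx0 subr0 /flat; case: ifPn => q0; last by rewrite scaler0 normr0.
have sE (a b : R) : a *: b = a * b by [].
rewrite !sE !normrM; set y := q.[_].
have yE : `|y| = y by rewrite ger0_norm ?ltW.
have eE : `|expR (- y^-1)| = expR (- y^-1) by rewrite ger0_norm ?expR_ge0.
have kE : `|y^-1 ^+ k| = y^-1 ^+ k by rewrite ger0_norm ?exprn_ge0 ?invr_ge0 ?ltW.
have nE : `|(k.+2)`!%:R| = (k.+2)`!%:R :> R by rewrite ger0_norm.
rewrite yE eE kE nE.
have -> : `|P.[h * 1 + x]| * (k.+2)`!%:R * y * (`|h^-1| * y) =
  `|h^-1| * (`|P.[h * 1 + x]| * ((k.+2)`!%:R * y ^+ 2)) by ring.
by rewrite ler_wpM2l// -mulrA ler_wpM2l// exprV_expR_le.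
Unshelve. all: by end_near.
Qed.

Lemma is_derive_flat q P k (x : R) :
  is_derive x 1 (flat q P k)
  (flat q (P^`() * q ^+ 2 - k%:R *: (P * q^`() * q) + P * q^`()) k.+2 x).
Proof.
have [qx|qx|qx] := ltgtP q.[x] 0; last 2 first.
- exact: is_derive_flat_pos.
- by rewrite {2}/flat qx ltxx; exact: is_derive_flat0.
rewrite {2}/flat ltNge ltW//=.
apply: (@near_eq_is_derive _ _ _ (cst 0)).
near=> y; rewrite /flat ltNge ltW//.
near: y; apply: (@cvgr_lt _ _ _ _ _ q.[x]) => //.
exact: continuous_horner.
Unshelve. all: by end_near. 
Qed.

Lemma smooth_flat q P k : smooth (flat q P k).
Proof.
move=> n x.
suff [P' [k' ->]] : exists P' k', derive1n n (flat q P k) = flat q P' k'.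
  by have [] := is_derive_flat q P' k' x.
elim: n => [|n [P' [k' IH]]]; first by exists P, k.
rewrite derive1nS IH.
eexists; eexists; apply/funext => y; rewrite derive1E.
by have [_ ->] := is_derive_flat q P' k' y.
Qed.

Lemma smooth_derive1 f : smooth f -> smooth (derive1 f).
Proof.
move=> sf n x; have := sf n.+1 x; rewrite /derive1n iterSr. exact.
Qed.

Lemma smooth_continuous f : smooth f -> continuous f.
Proof. by move=> sf x; apply/differentiable_continuous/derivable1_diffP/(sf 0%N). Qed.

Lemma derive1_affine f (k c x : R) : derivable f (k * x + c) 1 ->
  is_derive x 1 (fun y => f (k * y + c)) (k * derive1 f (k * x + c)).
Proof.
move=> df.
have h : is_derive x 1 (fun y : R => k * y + c) k.
  have -> : (fun y : R => k * y + c) = horner (k *: 'X + c%:P).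
    by apply/funext => y; rewrite !hornerE.
  by apply: is_derive_eq; rewrite derivD derivZ derivX derivC !hornerE.
rewrite mulrC; apply: (@is_derive1_comp _ f (fun y => k * y + c)).
by rewrite derive1E; exact: DeriveDef.
Qed.

Lemma smooth_affine f (k c : R) : smooth f -> smooth (fun x => f (k * x + c)).
Proof.
move=> sf n.
suff [K ->] : exists K : R, derive1n n (fun x => f (k * x + c)) =
    (fun x => K * derive1n n f (k * x + c)).
  move=> x; apply: derivableM; first exact: derivable_cst.
  by have [] := derive1_affine (sf n (k * x + c)).
elim: n => [|n [K IH]].
  by exists 1; apply/funext => x; rewrite mul1r.
exists (K * k); apply/funext => x; rewrite derive1nS IH derive1E.
have d := derive1_affine (sf n (k * x + c)).
have d2 := is_deriveM (is_derive_cst K x 1) d.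
have [_ ->] := d2.
by rewrite scaler0 addr0 /= /GRing.scale /= mulrA.
Qed.

End SmoothFunctions.

(** * Periodic extension of compactly supported functions *)

Section Periodization.
Context (R : realType) (a b : R).
Hypothesis ab : a < b.
Implicit Types f : R -> R.

Let L := b - a.
Let L0 : 0 < L. Proof. by rewrite subr_gt0. Qed.

(** The number of periods by which [x] has to be moved back to land in [[a, b[]. *)
Let turn (x : R) : R := (Num.floor ((x - a) / L))%:~R.

Definition periodize f (x : R) : R := f (x - L * turn x).

Let turn_itv x : a <= x - L * turn x < b.
Proof.
have /andP[] := floor_itv ((x - a) / L); rewrite -/(turn x) intrD.
rewrite ler_pdivlMr// ltr_pdivrMr// /L => h1 h2.
by apply/andP; split; lra.
Qed.

Let turn_uniq x (n : int) : a <= x - L * n%:~R < b -> turn x = n%:~R.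
Proof.
move=> /andP[h1 h2]; rewrite /turn (@floor_def _ _ n)// intrD.
rewrite ler_pdivlMr// ltr_pdivrMr// /L.
by apply/andP; split; move: h1 h2; rewrite /L; lra.
Qed.

Lemma periodize_id f x : a <= x < b -> periodize f x = f x.
Proof. by move=> h; rewrite /periodize (@turn_uniq x 0) ?mulr0 ?subr0. Qed.

Lemma periodize_periodic f x : periodize f (x + (b - a)) = periodize f x.
Proof.
rewrite /periodize (@turn_uniq (x + (b - a)) (Num.floor ((x - a) / L) + 1)); last first.
  by have := turn_itv x; rewrite intrD -/(turn x) /L; lra.
by rewrite intrD -/(turn x) /L; congr f; lra.
Qed.

Definition vanishes_outside (c d : R) f := forall x, f x != 0 -> c <= x <= d.

Lemma derive1_vanishes_outside c d f :
  vanishes_outside c d f -> vanishes_outside c d (derive1 f).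
Proof.
move=> fcd x; apply: contraNT => xcd.
rewrite derive1E -(derive_cst (0:R) x 1).
apply/eqP; apply: near_eq_derive.
have : \forall y \near x, ~~ (c <= y <= d).
  move: xcd; rewrite negb_and -!ltNge => /orP[xc|xd].
    near=> y; rewrite negb_and -!ltNge; apply/orP; left.
    by near: y; exact: lt_nbhsl.
  near=> y; rewrite negb_and -!ltNge; apply/orP; right.
  by near: y; exact: lt_nbhsr.
apply: filterS => y ycd; apply/eqP; move: ycd; apply: contraNT; exact: fcd.
Unshelve. all: by end_near.
Qed.

(** Away from the translates of [a] the function [turn] is locally constant, and [periodize f] is
    locally a translate of [f]. Near such a translate both adjacent branches vanish, because [f]
    vanishes near [a] and near [b]. *)
Lemma is_derive_periodize c d f x : a < c -> d < b -> vanishes_outside c d f ->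
  derivable f (x - L * turn x) 1 ->
  is_derive x 1 (periodize f) (periodize (derive1 f) x).
Proof.
move=> ac db fcd df.
have sh : is_derive x 1 (fun y => f (1 * y + (- (L * turn x))))
    (1 * derive1 f (1 * x + (- (L * turn x)))).
  by apply: derive1_affine; rewrite mul1r.
have /andP[] := turn_itv x; rewrite le_eqVlt => /predU1P[ax xb|ax xb].
  have fa : derive1 f (x - L * turn x) = 0.
    apply/eqP/negPn/negP => /(derive1_vanishes_outside fcd) /andP[].
    by rewrite -ax; lra.
  rewrite /periodize fa.
  apply: (@near_eq_is_derive _ _ _ (cst 0)).
  (* Within this radius [y] stays in the zero margins of [f] and less than one period from [x]. *)
  have r0 : 0 < Num.min (Num.min (c - a) (b - d)) L.
    by rewrite !lt_min !subr_gt0 ac db.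
  near=> y.
  have : `|x - y| < Num.min (Num.min (c - a) (b - d)) L.
    by near: y; exact: cvgr_dist_lt.
  rewrite !lt_min !ltr_norml => /andP[/andP[/andP[h1 h2] /andP[h3 h4]] /andP[h5 h6]].
  apply/esym/eqP/negPn/negP => /fcd.
  have Leq : L = b - a by [].
  (* To the right of the seam [y] has made as many turns as [x], to the left one fewer. *)
  have [xy|xy] := leP x y.
    rewrite (@turn_uniq y (Num.floor ((x - a) / L))) -/(turn x).
      by move: ax; set s := L * turn x => ax /andP[]; lra.
    by move: ax; set s := L * turn x => ax; apply/andP; split; lra.
  rewrite (@turn_uniq y (Num.floor ((x - a) / L) - 1)) intrB -/(turn x) mulrBr mulr1.
    by move: ax; set s := L * turn x => ax /andP[]; lra.
  by move: ax; set s := L * turn x => ax; apply/andP; split; lra.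
rewrite [X in is_derive _ _ _ X](_ : _ =
    1 * derive1 f (1 * x + (- (L * turn x)))); last by rewrite !mul1r.
apply: near_eq_is_derive sh.
near=> y; rewrite mul1r /periodize.
suff -> : turn y = turn x by [].
apply: turn_uniq; rewrite -/(turn x); apply/andP; split.
  have : a + L * turn x < y.
    by near: y; apply: lt_nbhsr; lra.
  lra.
have : y < b + L * turn x.
  by near: y; apply: lt_nbhsl; lra.
lra.
Unshelve. all: by end_near.
Qed.

Lemma smooth_periodize c d f : a < c -> d < b -> vanishes_outside c d f ->
  smooth f -> smooth (periodize f).
Proof.
move=> ac db fcd sf n.
suff [-> fn] : derive1n n (periodize f) = periodize (derive1n n f) /\
    vanishes_outside c d (derive1n n f).
  by move=> x; have [] := is_derive_periodize ac db fn (sf n (x - L * turn x)).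
elim: n => [//|n [IH fn]]; split.
  rewrite !derive1nS IH; apply/funext => x; rewrite derive1E.
  by have [_ ->] := is_derive_periodize ac db fn (sf n (x - L * turn x)).
by rewrite derive1nS; exact: derive1_vanishes_outside.
Qed.

Lemma test_extension bc phi : Ccinfty a b phi -> exists phi', [/\ test bc a b phi',
  forall x, a <= x < b -> phi' x = phi x &
  forall x, a < x < b -> derive1 phi' x = derive1 phi x].
Proof.
move=> [sphi [c [d [ac db phicd]]]].
case: bc => [|A B|]; [exists phi; split => //; split => //; exists c, d; split => //..|].
exists (periodize phi); split.
- split; first exact: smooth_periodize phicd sphi.
  exact: periodize_periodic.
- exact: periodize_id.
- move=> x /andP[ax xb]; rewrite derive1E.
  have [_ ->] := is_derive_periodize ac db phicd (sphi 0%N (x - L * turn x)).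
  by rewrite periodize_id ?ltW.
Qed.

End Periodization.

(** * A bump function and its rescalings *)

Section Bump.
Context (R : realType).

(** The support is [[1, 2]], away from [0], so that every rescaling about a point lies strictly on
    one side of it. *)
Definition bump : R -> R := flat (('X - 1%:P) * (2%:P - 'X)) 1 0.

Lemma bumpE x : bump x = if 0 < (x - 1) * (2 - x) then
  expR (- ((x - 1) * (2 - x))^-1) else 0.
Proof. by rewrite /bump /flat !hornerE ?expr0 ?mul1r. Qed.

Lemma smooth_bump : smooth bump. Proof. exact: smooth_flat. Qed.

Lemma bump_ge0 x : 0 <= bump x.
Proof. by rewrite bumpE; case: ifP => // _; exact: expR_ge0. Qed.

Lemma bump_support x : bump x != 0 -> 1 <= x <= 2.
Proof.
rewrite bumpE; case: ifP; last by rewrite eqxx.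
by move=> h _; apply/andP; split; nra.
Qed.

Lemma bump_lower : exists2 m : R, 0 < m &
  forall x, 4 / 3 <= x <= 5 / 3 -> m <= bump x.
Proof.
(* On the middle third, [(x - 1) (2 - x)] is at least [1/3 * 2/3 = 2/9]. *)
exists (expR (- (9 / 2))) => [|x /andP[h1 h2]]; first exact: expR_gt0.
rewrite bumpE.
have h : 2 / 9 <= (x - 1) * (2 - x) by nra.
rewrite ifT; last by apply: lt_le_trans h; lra.
rewrite ler_expR lerN2 -[leRHS]invrK lef_pV2 ?posrE; [|lra|lra].
by rewrite invf_div.
Qed.

Lemma derive1_bump_bounded : exists2 K : R, 0 < K & forall x, `|derive1 bump x| <= K.
Proof.
have cb : continuous (derive1 bump).
  by apply: smooth_continuous; apply: smooth_derive1; exact: smooth_bump.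
have cn : {within `[(1:R), 2], continuous (fun x => `|derive1 bump x|)}.
  apply: continuous_subspaceT => x; apply: continuous_comp; first exact: cb.
  exact: norm_continuous.
have le12 : 1 <= 2 :> R by lra.
have [c _ cmax] := EVT_max le12 cn.
(* Adding [1] makes the bound strictly positive, as a divisor must be. *)
exists (`|derive1 bump c| + 1); first by rewrite ltr_wpDl.
move=> x; have [x12|x12] := boolP (1 <= x <= 2).
  by apply: (le_trans (cmax x _)); rewrite ?in_itv//= lerDl.
have -> : derive1 bump x = 0.
  apply/eqP; move: x12; apply: contraNT.
  exact: (derive1_vanishes_outside bump_support).
by rewrite normr0 addr_ge0.
Qed.

(** The scale [e] may be negative: the bump then sits to the left of [x0], at distances between
    [|e|] and [2 |e|]. *)
Definition bump_at (x0 e : R) (x : R) : R := bump (e^-1 * x + - (e^-1 * x0)).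

End Bump.

(** * Measurability, integrability and integration by parts on the interval *)

Section Intervals.
Context (R : realType) (a b : R).
Hypothesis ab : a < b.
Local Notation mu := (@lebesgue_measure R).
Implicit Types (f g v phi : R -> R) (nu : {charge set R -> \bar R})
  (m : {finite_measure set R -> \bar R}).

Lemma measurable_domain bc : measurable (domain bc a b).
Proof. by case: bc => *; exact: measurable_itv. Qed.

Lemma sub_domain bc : `]a, b[ `<=` domain bc a b.
Proof.
case: bc => [|A B|] x //; rewrite /domain/= !in_itv/=.
by move=> /andP[/ltW -> ->].
Qed.

Lemma domain_sub bc : domain bc a b `<=` `[a, b].
Proof.
by case: bc => [|A B|] x; rewrite /domain/= !in_itv/= => /andP[h1 h2];
  rewrite (ltW h2) ?h1 ?(ltW h1).
Qed.

Lemma within_continuous_bounded f : {within `[a, b], continuous f} ->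
  exists2 M, 0 < M & forall x, a <= x <= b -> `|f x| <= M.
Proof.
move=> cf.
have cn : {within `[a, b], continuous (fun x => `|f x|)}.
  by move=> x; apply: continuous_comp; [exact: cf|exact: norm_continuous].
have [c _ cmax] := EVT_max (ltW ab) cn.
exists (`|f c| + 1); first by rewrite ltr_wpDl.
by move=> x xab; apply: (le_trans (cmax x _)); rewrite ?in_itv//= lerDl.
Qed.

Lemma continuous_measurable f D : measurable D -> continuous f -> measurable_fun D f.
Proof.
move=> mD cf; apply: (@measurable_funS _ _ _ _ setT) => //.
exact: continuous_measurable_fun.
Qed.

Lemma continuous_integrable_cc f : continuous f -> mu.-integrable `[a, b] (EFin \o f).
Proof.
move=> cf; apply: continuous_compact_integrable; first exact: segment_compact.
exact: continuous_subspaceT.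
Qed.

Lemma continuous_integrable f : continuous f -> mu.-integrable `]a, b[ (EFin \o f).
Proof.
move=> /continuous_integrable_cc; apply: integrableS => //.
exact: subset_itv_oo_cc.
Qed.

Lemma Rintegral_oo_cc f : continuous f ->
  \int[mu]_(x in `]a, b[) f x = \int[mu]_(x in `[a, b]) f x.
Proof.
move=> cf; rewrite Rintegral_itv_bndo_bndc; last exact: continuous_integrable.
rewrite Rintegral_itv_obnd_cbnd//.
apply: integrableS (continuous_integrable_cc cf) => //.
exact: subset_itv_oc_cc.
Qed.

Lemma smooth_LRcontinuous f (c d : R) : smooth f -> derivable_oo_LRcontinuous f c d.
Proof.
move=> sf; split; first by move=> x _; exact: (sf 0%N).
- by apply: cvg_at_right_filter; exact: smooth_continuous.
- by apply: cvg_at_left_filter; exact: smooth_continuous.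
Qed.

Lemma Rintegral_derive1 phi : smooth phi ->
  \int[mu]_(x in `]a, b[) derive1 phi x = phi b - phi a.
Proof.
move=> sphi.
have cphi : continuous (derive1 phi) by apply: smooth_continuous; exact: smooth_derive1.
rewrite Rintegral_oo_cc//.
rewrite /Rintegral (continuous_FTC2 ab _ (smooth_LRcontinuous a b sphi))//.
exact: continuous_subspaceT.
Qed.

Lemma Rintegral_id_derive1 phi : smooth phi ->
  \int[mu]_(x in `]a, b[) (x * derive1 phi x) =
  b * phi b - a * phi a - \int[mu]_(x in `]a, b[) phi x.
Proof.
move=> sphi.
have cphi : continuous (derive1 phi) by apply: smooth_continuous; exact: smooth_derive1.
rewrite !Rintegral_oo_cc; last 2 first.
- exact: smooth_continuous.
- by move=> x; apply: continuousM => //; exact: cphi.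
rewrite (@Rintegration_by_parts _ id phi (cst 1) (derive1 phi))//.
- by congr (_ - _); apply: eq_Rintegral => x _; rewrite mul1r.
- by apply: continuous_subspaceT => x; exact: cst_continuous.
- split => //.
  + exact: cvg_at_right_filter.
  + exact: cvg_at_left_filter.
- by move=> x _; rewrite derive1_id.
- exact: continuous_subspaceT.
- exact: smooth_LRcontinuous.
Qed.

Lemma integrable_mul_continuous v f : mu.-integrable `]a, b[ (EFin \o v) ->
  continuous f -> mu.-integrable `]a, b[ (EFin \o (fun x => v x * f x)).
Proof.
move=> vi cf.
have [M _ fM] := within_continuous_bounded
  (continuous_subspaceT cf : {within `[a, b], continuous f}).
have -> : EFin \o (fun x => v x * f x) = ((EFin \o f) \* (EFin \o v))%E.
  by apply/funext => x /=; rewrite mulrC EFinM.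
apply: integrableMr => //; first exact: continuous_measurable.
exists M; split; first exact: num_real.
move=> y /ltW My x /=; rewrite in_itv/= => /andP[ax xb].
by apply: le_trans (fM x _) My; rewrite !ltW.
Qed.

End Intervals.

(** * Restrictions of measures, and finite measures as charges *)

Section RestrictedMeasures.
Context (R : realType).
Implicit Types (D K : set R) (f : R -> R) (m : {finite_measure set R -> \bar R}).

Lemma Rintegral_mfrestr (m : {measure set R -> \bar R}) D K (mK : measurable K)
    (mKoo : (m K < +oo)%E) f (M : R) :
  measurable D -> K `<=` D -> measurable_fun D f -> (forall x, D x -> `|f x| <= M) ->
  \int[mfrestr mK mKoo]_(x in D) f x = \int[m]_(x in K) f x.
Proof.
move=> mD KD mf fM.
rewrite (@Rintegral_concentrated _ _ _ (mfrestr mK mKoo) _ K _ M)//; last first.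
  by transitivity (m (~` K `&` K)) => //; rewrite setICl measure0.
rewrite /Rintegral; congr fine; apply: eq_measure_integral => A mA AK.
by transitivity (m (A `&` K)) => //; rewrite (setIidl AK).
Qed.

Lemma charge_integral_finite_measure m D f (M : R) :
  measurable D -> measurable_fun D f -> (forall x, D x -> `|f x| <= M) ->
  charge_integral (charge_of_finite_measure m) D f = \int[m]_(x in D) f x.
Proof.
move=> mD mf fM.
have int : m.-integrable D (EFin \o f) by exact: bounded_integrable fM.
(* The measure is split as [(m + m) - m], a difference of finite measures. *)
rewrite (@charge_integralE _ _ (measure_add m m) m _ _ M)//.
  by rewrite Rintegral_measure_add//; lra.
move=> E mE; transitivity (m E + m E - m E)%E.
  by rewrite addeK//; exact: fin_num_measure.
by congr (_ - _)%E; symmetry; exact: finite_measure_addE.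
Qed.

End RestrictedMeasures.

(** * Distribution functions as primitives of measures *)

Section DistributionFunction.
Context (R : realType) (a b : R).
Hypothesis ab : a < b.
Local Notation mu := (@lebesgue_measure R).

Let id_R : measurableTypeR R -> R := idfun.

Let measurable_id_R : measurable_fun setT id_R.
Proof. exact: (@measurable_id _ _ setT). Qed.

Let muR : set R -> \bar R := mu.

Let muR0 : muR set0 = 0%E. Proof. exact: measure0. Qed.

Let muR_ge0 A : (0 <= muR A)%E. Proof. exact: measure_ge0. Qed.

Let muR_sigma_additive : semi_sigma_additive muR.
Proof. exact: (@measure_semi_sigma_additive _ _ _ mu). Qed.

#[local] HB.instance Definition _ :=
  isMeasure.Build _ _ _ muR muR0 muR_ge0 muR_sigma_additive.

Lemma lebesgue_oo_lty : (muR `]a, b[%classic < +oo)%E.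
Proof.
rewrite (_ : muR _ = mu `]a, b[%classic)// lebesgue_measure_itv/= lte_fin ab.
by rewrite -EFinB ltry.
Qed.

(* [lebesgue_measure] lives on [measurableTypeR R], whose display differs from
   that of [R]: it is transported along the identity. *)
Definition lebesgue_on : {finite_measure set R -> \bar R} :=
  mfrestr (measurable_itv `]a, b[%O) lebesgue_oo_lty.

Lemma Rintegral_lebesgue_on D (f : R -> R) (M : R) : measurable D -> `]a, b[ `<=` D ->
  measurable_fun D f -> (forall x, D x -> `|f x| <= M) ->
  \int[lebesgue_on]_(x in D) f x = \int[mu]_(x in `]a, b[) f x.
Proof.
move=> mD abD mf fM; rewrite (@Rintegral_mfrestr _ _ _ _ _ _ _ M)//.
have mfab : measurable_fun `]a, b[ f.
  by apply: (measurable_funS mD abD); exact: mf.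
(* Extension by zero makes the integrand measurable on the whole line, as needed for the change of
   variables along [id_R]. *)
have -> : \int[muR]_(x in `]a, b[) f x = \int[muR]_(x in `]a, b[) (f \_ `]a, b[) x.
  by apply: eq_Rintegral => x xab; rewrite patchT.
have -> : \int[mu]_(x in `]a, b[) f x = \int[mu]_(x in `]a, b[) (f \_ `]a, b[) x.
  by apply: eq_Rintegral => x xab; rewrite patchT.
have mfT : measurable_fun setT (f \_ `]a, b[) by apply: (measurable_restrictT f _).1.
congr fine.
apply: (@integral_pushforward _ _ _ _ R id_R measurable_id_R mu `]a, b[
  (EFin \o (f \_ `]a, b[))) => //.
  exact/measurable_EFinP.
apply: measurable_bounded_integrable => //.
- exact: measurable_itv.
- exact: lebesgue_oo_lty.
- by apply: (measurable_funS measurableT) => //; exact: mfT.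
- exists M; split; first exact: num_real.
  move=> y /ltW My x /= xab; rewrite patchT ?inE//.
  by apply: le_trans My; exact/fM/abD.
Qed.

Variable m : {finite_measure set R -> \bar R}.

Definition mass_le (x : R) : R := fine (m `]-oo, x]).

Lemma mass_le_bounded x : `|mass_le x| <= fine (m setT).
Proof.
rewrite /mass_le ger0_norm ?fine_ge0// fine_le ?fin_num_measure//.
by rewrite le_measure ?inE.
Qed.

Lemma measurable_mass_le D : measurable D -> measurable_fun D mass_le.
Proof.
move=> mD; apply: (@measurable_funS _ _ _ _ setT) => //.
apply: nondecreasing_measurable => // x y xy.
rewrite /mass_le fine_le ?fin_num_measure// le_measure ?inE//.
by move=> z; rewrite /= !in_itv/= => /le_trans; exact.
Qed.

Variables (K : set R) (mK : measurable K).
Hypothesis Kab : K `<=` `]a, b[.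
Hypothesis m0 : m (~` K) = 0%E.

(** Integration by parts, obtained from Fubini on the region [y <= x]. The term [phi b] is kept
    because a periodic test function need not vanish at the ends; it cancels between two measures of
    equal mass. *)
Lemma Rintegral_mass_le_derive1 bc phi : smooth phi ->
  \int[mu]_(x in `]a, b[) (mass_le x * derive1 phi x) =
  \int[m]_(y in domain bc a b) (phi b - phi y).
Proof.
move=> sphi.
have cphi : continuous phi by exact: smooth_continuous.
have cdphi : continuous (derive1 phi) by apply: smooth_continuous; exact: smooth_derive1.
have [M M0 phiM] := within_continuous_bounded ab
  (continuous_subspaceT cdphi : {within `[a, b], continuous (derive1 phi)}).
have [N N0 phiN] := within_continuous_bounded ab
  (continuous_subspaceT cphi : {within `[a, b], continuous phi}).
(* Integrated in the second variable, [g] gives [mass_le x * phi'(x)]; integrated in the first, it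
   gives the increment of [phi] from [y] to [b]. *)
pose g (p : R * R) : R := if (a < p.1 < b) && (p.2 <= p.1) then derive1 phi p.1 else 0.
have gM p : `|g p| <= M.
  rewrite /g; case: ifP => [/andP[/andP[h1 h2] _]|_]; last by rewrite normr0 ltW.
  by apply: phiM; rewrite !ltW.
have mg : measurable_fun setT g.
  apply: measurable_fun_ifT => //.
    apply: measurable_and; [apply: measurable_and|].
    - by apply: measurable_fun_ltr => //; exact: measurable_fst.
    - by apply: measurable_fun_ltr => //; exact: measurable_fst.
    - by apply: measurable_fun_ler; [exact: measurable_snd|exact: measurable_fst].
  apply: measurableT_comp; last exact: measurable_fst.
  exact: continuous_measurable.
have mg1 x : measurable_fun setT (fun y => g (x, y)) by exact: measurableT_comp.
have mg2 y : measurable_fun setT (fun x => g (x, y)) by exact: measurableT_comp.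
have ig : (lebesgue_on \x m)%E.-integrable setT (EFin \o g).
  apply/integrable12ltyP; first exact/measurable_EFinP.
  apply: (@le_lt_trans _ _ (\int[lebesgue_on]_x \int[m]_y M%:E)%E).
    apply: ge0_le_integral => //.
    - by move=> x _; exact: integral_ge0.
    - apply: (measurable_fun_fubini_tonelli_F (abse \o EFin \o g)) => //.
        by apply: measurableT_comp => //; exact/measurable_EFinP.
      by move=> p /=; rewrite lee_fin.
    - move=> x _; apply: ge0_le_integral => //.
      + by apply: measurableT_comp => //; exact/measurable_EFinP.
      + by move=> y _; rewrite /= lee_fin.
  rewrite (eq_integral (cst (M * fine (m setT))%:E)); last first.
    by move=> x _; rewrite integral_cst// EFinM fineK// fin_num_measure.
  rewrite integral_cst//.
  have : ((M * fine (m setT))%:E * lebesgue_on setT)%E \is a fin_num.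
    by rewrite fin_numM//; exact: fin_num_measure.
  by rewrite fin_numElt => /andP[].
have Fub := Fubini ig.
have EF x : (\int[m]_y (EFin \o g) (x, y) =
    (if a < x < b then mass_le x * derive1 phi x else 0)%:E)%E.
  case: ifP => xab; last first.
    by rewrite integral0_eq// => y _; rewrite /g/= xab.
  rewrite (eq_integral
    (fun y => ((derive1 phi x)%:E * (\1_(`]-oo, x]) y)%:E)%E)); last first.
    move=> y _; rewrite /g/= xab/= -EFinM indicE; case: ifP => yx.
      by rewrite mem_set ?mulr1//= in_itv/= yx.
    by rewrite memNset ?mulr0//= in_itv/= yx.
  rewrite integralZl//; last exact: integrable_indic.
  by rewrite integral_indic// setIT mulrC EFinM /mass_le fineK// fin_num_measure.
have EG y : K y -> (\int[lebesgue_on]_x (EFin \o g) (x, y) = (phi b - phi y)%:E)%E.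
  move=> /Kab; rewrite /= in_itv/= => /andP[ay yb].
  rewrite -[LHS]fineK; last first.
    by apply: integrable_fin_num => //; apply: (@bounded_integrable _ _ _ _ _ _ M).
  congr EFin.
  transitivity (\int[mu]_(x in `]a, b[) g (x, y)).
    exact: (@Rintegral_lebesgue_on setT (fun x => g (x, y)) M).
  transitivity (\int[mu]_(x in `]a, b[) (derive1 phi \_ `[y, +oo[) x).
    apply: eq_Rintegral => x; rewrite inE/= in_itv/= => xab.
    rewrite /g/= xab/= patchE; case: ifP => yx.
      by rewrite mem_set//= in_itv/= yx.
    by rewrite memNset//= in_itv/= yx.
  rewrite -Rintegral_mkcondr.
  have -> : `]a, b[%classic `&` `[y, +oo[%classic = `[y, b[%classic.
    apply/seteqP; split => x /=; rewrite !in_itv/= ?andbT.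
      by move=> [/andP[_ ->] ->].
    by move=> /andP[yx xb]; rewrite xb (lt_le_trans ay yx).
  rewrite -Rintegral_itv_obnd_cbnd; first exact: Rintegral_derive1.
  exact: continuous_integrable.
transitivity (\int[lebesgue_on]_x (if a < x < b then mass_le x * derive1 phi x else 0)).
  rewrite (@Rintegral_lebesgue_on setT _ (fine (m setT) * M))//.
  - by apply: eq_Rintegral => x; rewrite inE/= in_itv/= => ->.
  - apply: measurable_fun_ifT => //.
      by apply: measurable_and; exact: measurable_fun_ltr.
    by apply: measurable_funM; [exact: measurable_mass_le|exact: continuous_measurable].
  - move=> x _; case: ifP => [/andP[ax xb]|_].
      by rewrite normrM ler_pM// ?mass_le_bounded// phiM// !ltW.
    by rewrite normr0; apply: mulr_ge0; [exact: fine_ge0|exact: ltW].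
rewrite (@Rintegral_concentrated _ _ _ m (domain bc a b) K _ (N + N)); last 6 first.
- exact: measurable_domain.
- exact: mK.
- exact: subset_trans Kab (@sub_domain _ a b bc).
- exact: m0.
- apply: measurable_funB; first exact: measurable_cst.
  by apply: continuous_measurable => //; exact: measurable_domain.
- move=> y /domain_sub; rewrite /= in_itv/= => /phiN yN.
  by rewrite (le_trans (ler_normB _ _))// lerD// phiN// ltW//= lexx.
congr fine; under eq_integral do rewrite -EF.
rewrite Fub (negligible_integral (measurableC mK) measurableT _ m0); last first.
  have mG := measurable_fubini_G ig.
  apply/integrableP; split; first exact: mG.
  have mEg : measurable_fun setT (EFin \o g) by exact/measurable_EFinP.
  apply: le_lt_trans ((integrable21ltyP _ _ mEg).1 ig).
  apply: ge0_le_integral => //.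
  - by apply: measurableT_comp => //; exact: mG.
  - apply: (measurable_fun_fubini_tonelli_G (abse \o (EFin \o g))) => //.
      exact: measurableT_comp.
    by move=> p; rewrite /= lee_fin.
  - move=> y _; apply: le_abse_integral => //.
    by apply/measurable_EFinP; exact: (mg2 y).
rewrite setTD setCK; apply: eq_integral => y /set_mem Ky.
exact: EG.
Qed.

End DistributionFunction.

(** * Distributional derivatives, tilts and perturbations *)

Section DistributionalDerivative.
Context (R : realType) (a b : R).
Hypothesis ab : a < b.
Local Notation mu := (@lebesgue_measure R).
Local Notation pos nu := (jordan_pos (hahn_posnegP nu)).
Local Notation neg nu := (jordan_neg (hahn_posnegP nu)).
Implicit Types (bc : bdry_cond R) (v w phi : R -> R) (nu : {charge set R -> \bar R})
  (m : {finite_measure set R -> \bar R}).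

Local Notation dom bc := (domain bc a b).

Lemma test_smooth bc phi : test bc a b phi -> smooth phi.
Proof. by case: bc => [|A B|] []. Qed.

Lemma Ccinfty_ends phi : Ccinfty a b phi -> phi a = 0 /\ phi b = 0.
Proof.
move=> [_ [c [d [ac db h]]]]; split; apply/eqP/negPn/negP => /h /andP[]; lra.
Qed.

Lemma test_bounded bc phi : test bc a b phi ->
  exists2 M, 0 < M & forall x, dom bc x -> `|phi x| <= M.
Proof.
move=> /test_smooth/smooth_continuous cphi.
have [M M0 h] := within_continuous_bounded ab
  (continuous_subspaceT cphi : {within `[a, b], continuous phi}).
by exists M => // x /domain_sub; rewrite /= in_itv/=; exact: h.
Qed.

Lemma test_measurable bc phi : test bc a b phi -> measurable_fun (dom bc) phi.
Proof.
move=> /test_smooth/smooth_continuous; apply: continuous_measurable.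
exact: measurable_domain.
Qed.

Lemma integrable_mul_derive1_test bc v phi : test bc a b phi ->
  mu.-integrable `]a, b[ (EFin \o v) ->
  mu.-integrable `]a, b[ (EFin \o (fun x => v x * derive1 phi x)).
Proof.
move=> tphi vi; apply: integrable_mul_continuous => //.
by apply: smooth_continuous; apply: smooth_derive1; exact: test_smooth tphi.
Qed.

Definition leb : {charge set R -> \bar R} := charge_of_finite_measure (lebesgue_on ab).

Definition tilt (d : R) nu : {charge set R -> \bar R} := cadd nu (cscale d leb).

Lemma charge_integral_tilt bc d nu phi : test bc a b phi ->
  charge_integral (tilt d nu) (dom bc) phi =
  charge_integral nu (dom bc) phi + d * \int[mu]_(x in `]a, b[) phi x.
Proof.
move=> tphi; have [M _ phiM] := test_bounded tphi.
have mphi := test_measurable tphi; have mD := measurable_domain a b bc.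
rewrite (@charge_integral_cadd _ _ _ _ _ M)// (@charge_integral_cscale _ _ _ _ _ M)//.
rewrite (@charge_integral_finite_measure _ _ _ _ M)//.
by rewrite (@Rintegral_lebesgue_on _ _ _ _ _ _ M)//; exact: sub_domain.
Qed.

Lemma id_integrable : mu.-integrable `]a, b[ (EFin \o (id : R -> R)).
Proof. by apply: continuous_integrable => x; exact: cvg_id. Qed.

(** For compactly supported test functions, integrating [x phi'] by parts leaves no boundary term.
    On the circle the added Lebesgue term is already part of the meaning of the tilt. *)
Lemma is_D_tilt_tilt bc v d nu : mu.-integrable `]a, b[ (EFin \o v) ->
  is_D bc a b v nu -> is_D_tilt bc a b v d (tilt d nu).
Proof.
move=> vi; rewrite /is_D /is_D_tilt => Dv.
have noper : (forall phi, test bc a b phi -> Ccinfty a b phi) ->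
    is_D bc a b (fun x => v x + d * x) (tilt d nu).
  move=> tC phi tphi; rewrite charge_integral_tilt// opprD -Dv//.
  have sphi := test_smooth tphi.
  have [pa pb] := Ccinfty_ends (tC _ tphi).
  have idphi := Rintegral_id_derive1 ab sphi.
  have ii := integrable_mul_derive1_test tphi id_integrable.
  transitivity (\int[mu]_(x in `]a, b[) (v x * derive1 phi x + d * (x * derive1 phi x))).
    by apply: eq_Rintegral => x _; ring.
  rewrite RintegralD//.
  - by rewrite RintegralZl// idphi pa pb; ring.
  - exact: integrable_mul_derive1_test tphi vi.
  - exact: (integrableZl _ d ii).
case: bc Dv noper => [Dv noper|A B Dv noper|Dv _]; [exact: noper..|].
move=> phi tphi; rewrite charge_integral_tilt// opprD -Dv//.
Qed.

Lemma is_D_add bc v h nu sigma : mu.-integrable `]a, b[ (EFin \o v) ->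
  mu.-integrable `]a, b[ (EFin \o h) ->
  is_D bc a b v nu -> is_D bc a b h sigma ->
  is_D bc a b (fun x => v x + h x) (cadd nu sigma).
Proof.
move=> vi hi Dv Dh phi tphi.
have [M _ phiM] := test_bounded tphi.
rewrite (@charge_integral_cadd _ _ _ _ _ M)//; last 2 first.
- exact: measurable_domain.
- exact: test_measurable.
rewrite opprD -Dv// -Dh// -RintegralD//.
- by apply: eq_Rintegral => x _; rewrite mulrDl.
- exact: integrable_mul_derive1_test tphi vi.
- exact: integrable_mul_derive1_test tphi hi.
Qed.

(** Both tilted measures in the energy thus move by the same [sigma]. *)
Lemma is_D_tilt_add bc v d h nu sigma : mu.-integrable `]a, b[ (EFin \o v) ->
  mu.-integrable `]a, b[ (EFin \o h) ->
  is_D_tilt bc a b v d nu -> is_D bc a b h sigma ->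
  is_D_tilt bc a b (fun x => v x + h x) d (cadd nu sigma).
Proof.
move=> vi hi Dv Dh.
have vdi : mu.-integrable `]a, b[ (EFin \o (fun x => v x + d * x)).
  have := integrableD _ vi (integrableZl _ d id_integrable).
  by apply => //.
have E : (fun x => v x + h x + d * x) = (fun x => (v x + d * x) + h x).
  by apply/funext => x; ring.
case: bc Dv Dh => [Dv Dh|A B Dv Dh|Dv Dh phi tphi].
- by rewrite /is_D_tilt E; exact: is_D_add.
- by rewrite /is_D_tilt E; exact: is_D_add.
have [M _ phiM] := test_bounded tphi.
rewrite (@charge_integral_cadd _ _ _ _ _ M)//; last 2 first.
- exact: measurable_domain.
- exact: test_measurable.
rewrite opprD -Dv// -Dh// addrAC -RintegralD//.
- by congr (_ - _); apply: eq_Rintegral => x _; rewrite mulrDl.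
- exact: integrable_mul_derive1_test tphi vi.
- exact: integrable_mul_derive1_test tphi hi.
Qed.

Lemma cscaleN1E nu E : cscale (-1) nu E = (- nu E)%E.
Proof. by rewrite cscaleN1. Qed.

Section DifferenceOfMeasures.
Variables (m1 m2 : {finite_measure set R -> \bar R}) (K : set R).
Hypotheses (mK : measurable K) (Kab : K `<=` `]a, b[).
Hypotheses (m1K : m1 (~` K) = 0%E) (m2K : m2 (~` K) = 0%E).

Definition primitive (x : R) : R := mass_le m2 x - mass_le m1 x.

Definition difference : {charge set R -> \bar R} :=
  cadd (charge_of_finite_measure m2) (cscale (-1) (charge_of_finite_measure m1)).

Lemma differenceE E : difference E = (m2 E - m1 E)%E.
Proof.
transitivity (charge_of_finite_measure m2 E +
  cscale (-1) (charge_of_finite_measure m1) E)%E; first by [].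
by rewrite (cscaleN1E (charge_of_finite_measure m1)).
Qed.

Lemma primitive_integrable : mu.-integrable `]a, b[ (EFin \o primitive).
Proof.
apply: (@measurable_bounded_integrable _ _ _ mu) => //.
- exact: lebesgue_oo_lty.
- by apply: measurable_funB; exact: measurable_mass_le.
exists (fine (m2 setT) + fine (m1 setT)); split; first exact: num_real.
move=> y /ltW My x _; apply: le_trans My.
by rewrite (le_trans (ler_normB _ _))// lerD// mass_le_bounded.
Qed.

Lemma mass_domain bc m : m (~` K) = 0%E -> m (dom bc) = m setT.
Proof.
move=> m0.
have mD := measurable_domain a b bc.
have : m (~` dom bc) = 0%E.
  apply: subset_measure0 m0; [exact: measurableC|exact: measurableC|].
  by apply: subsetC; apply: subset_trans Kab _; exact: sub_domain.
move=> mDC0; transitivity (m (dom bc `|` ~` dom bc)); last by rewrite setUv.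
transitivity (m (dom bc) + m (~` dom bc))%E; first by rewrite mDC0 adde0.
by symmetry; apply: measureU => //; [exact: measurableC|exact: setICr].
Qed.

(** Equal masses cancel the two boundary terms [phi b * m setT], which is what makes the statement
    hold on the circle as well. *)
Lemma is_D_primitive bc : fine (m1 setT) = fine (m2 setT) ->
  is_D bc a b primitive difference.
Proof.
move=> m12 phi tphi; have [M _ phiM] := test_bounded tphi.
have sphi := test_smooth tphi.
have mD := measurable_domain a b bc.
have mphi := test_measurable tphi.
rewrite (@charge_integralE _ _ m2 m1 _ _ M)//; last by move=> E _; exact: differenceE.
have massi m : mu.-integrable `]a, b[ (EFin \o mass_le m).
  apply: (@measurable_bounded_integrable _ _ _ mu) => //.
  - exact: lebesgue_oo_lty.
  - exact: measurable_mass_le.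
  exists (fine (m setT)); split; first exact: num_real.
  by move=> y /ltW My x _; apply: le_trans My; exact: mass_le_bounded.
have int m : m (~` K) = 0%E -> \int[mu]_(x in `]a, b[) (mass_le m x * derive1 phi x) =
    phi b * fine (m setT) - \int[m]_(x in dom bc) phi x.
  move=> m0; rewrite (@Rintegral_mass_le_derive1 _ _ _ ab m K mK Kab m0 bc phi sphi).
  rewrite RintegralB//.
  - by rewrite Rintegral_cst//; congr (_ * fine _ - _); exact: mass_domain.
  - exact: finite_measure_integrable_cst.
  - exact: bounded_integrable phiM.
transitivity (\int[mu]_(x in `]a, b[)
    (mass_le m2 x * derive1 phi x - mass_le m1 x * derive1 phi x)).
  by apply: eq_Rintegral => x _; rewrite mulrBl.
rewrite RintegralB//; [|exact: integrable_mul_derive1_test tphi _..].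
by rewrite !int// m12; ring.
Qed.

End DifferenceOfMeasures.

(** Evaluate on the Hahn positive set of [nu]: there [pos nu] is [nu], hence at most [nu'], hence at
    most [pos nu']. This carries a domination over from one tilt to the other. *)
Lemma jordan_pos_mono nu nu' E :
  (forall E', measurable E' -> (nu E' <= nu' E')%E) -> measurable E ->
  (pos nu E <= pos nu' E)%E.
Proof.
move=> le mE; have mEP : measurable (E `&` hahn_pos nu).
  by apply: measurableI => //; exact: measurable_hahn_pos.
rewrite jordan_posI//; apply: (le_trans (le _ mEP)).
rewrite (jordan_diff nu' mEP); apply: (@le_trans _ _ (pos nu' (E `&` hahn_pos nu))).
  by rewrite geeDl// leeNl oppe0.
by apply: le_measure; rewrite ?inE.
Qed.

Lemma jordan_neg_mono nu nu' E :
  (forall E', measurable E' -> (nu' E' <= nu E')%E) -> measurable E ->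
  (neg nu E <= neg nu' E)%E.
Proof.
move=> le mE; have mEN : measurable (E `&` hahn_neg nu).
  by apply: measurableI => //; exact: measurable_hahn_neg.
rewrite jordan_negI//; apply: (@le_trans _ _ (- nu' (E `&` hahn_neg nu))%E).
  by rewrite leeN2 le.
rewrite (jordan_diff nu' mEN); apply: (@le_trans _ _ (neg nu' (E `&` hahn_neg nu))).
  rewrite fin_num_oppeB; last exact: fin_num_measure.
  by rewrite geeDr// leeNl oppe0.
by apply: le_measure; rewrite ?inE.
Qed.

Lemma tilt_le nu d e E : d <= e -> measurable E -> (tilt d nu E <= tilt e nu E)%E.
Proof.
move=> de mE; apply: leeD2l; apply: lee_wpmul2r; last by rewrite lee_fin.
exact: (@measure_ge0 _ _ _ (lebesgue_on ab)).
Qed.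

End DistributionalDerivative.

(** * The subdifferential inequality forbids a local sign change *)

Section Variation.
Context (R : realType) (a b : R).
Hypothesis ab : a < b.
Local Notation mu := (@lebesgue_measure R).
Local Notation pos nu := (jordan_pos (hahn_posnegP nu)).
Local Notation neg nu := (jordan_neg (hahn_posnegP nu)).
Local Notation dom bc := (domain bc a b).

Lemma within_continuous_measurable (f : R -> R) D : measurable D -> D `<=` `[a, b] ->
  {within `[a, b], continuous f} -> measurable_fun D f.
Proof.
move=> mD Dab cf; apply: (measurable_funS (measurable_itv `[a, b]%O) Dab).
exact: subspace_continuous_measurable_fun.
Qed.

Lemma ball_oscillation (f : R -> R) (x0 e : R) : a < x0 < b -> 0 < e ->
  {within `[a, b], continuous f} ->
  exists r, [/\ 0 < r, a < x0 - r, x0 + r < b &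
    forall x, x0 - r <= x <= x0 + r -> `|f x - f x0| <= e].
Proof.
move=> /andP[ax xb] e0 /(continuous_within_itvP f ab)[cf _ _].
have cx0 : {for x0, continuous f} by apply: cf; rewrite in_itv/= ax xb.
have /nbhs_ballP[r /= r0 rP] : \forall x \near x0, `|f x0 - f x| < e.
  by have /cvgrPdist_lt/(_ _ e0) := cx0.
(* Halving puts the closed interval strictly inside both the ball and []a, b[]. *)
exists (Num.min (r / 2) (Num.min ((x0 - a) / 2) ((b - x0) / 2))).
have : Num.min (r / 2) (Num.min ((x0 - a) / 2) ((b - x0) / 2)) <= r / 2.
  by rewrite ge_min lexx.
have : Num.min (r / 2) (Num.min ((x0 - a) / 2) ((b - x0) / 2)) <= (x0 - a) / 2.
  by rewrite !ge_min lexx orbT.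
have : Num.min (r / 2) (Num.min ((x0 - a) / 2) ((b - x0) / 2)) <= (b - x0) / 2.
  by rewrite !ge_min lexx !orbT.
have : 0 < Num.min (r / 2) (Num.min ((x0 - a) / 2) ((b - x0) / 2)).
  by rewrite !lt_min !divr_gt0// subr_gt0.
move: (Num.min _ _) => s s0 sb sa sr; split => //; [lra|lra|].
move=> x /andP[h1 h2]; rewrite distrC ltW// rP// /ball/= ltr_norml.
by apply/andP; split; lra.
Qed.

(** Here [d] is the opposite of the critical slope. The radius depends only on the oscillation of
    the continuous representative [omc]; two nonzero Jordan parts on that interval would give a
    competitor violating the selection inequality. *)
Lemma no_sign_change bc v om nu (d x0 : R) : a < x0 < b -> d = 1 \/ d = -1 ->
  mu.-integrable `]a, b[ (EFin \o v) -> is_D bc a b v nu ->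
  is_selection bc a b v om ->
  exists r, [/\ 0 < r, a < x0 - r, x0 + r < b &
    pos (tilt ab d nu) `[x0 - r, x0 + r] = 0%E \/
    neg (tilt ab d nu) `[x0 - r, x0 + r] = 0%E].
Proof.
move=> x0ab d1 vi Dv [omc [comc _ sel]].
have half0 : 0 < 1 / 2 :> R by lra.
have [r [r0 ar rb osc]] := ball_oscillation x0ab half0 comc.
exists r; split => //.
set K := `[x0 - r, x0 + r]%classic.
have mK : measurable K by exact: measurable_itv.
have Kab : K `<=` `]a, b[.
  by move=> x; rewrite /K/= !in_itv/= => /andP[h1 h2]; apply/andP; split; lra.
have mD := measurable_domain a b bc.
have KD : K `<=` dom bc by apply: subset_trans Kab (@sub_domain _ a b bc).
pose kappa := tilt ab d nu; rewrite -/kappa.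
have [|pos0] := eqVneq (pos kappa K) 0%E; first by left.
have [|neg0] := eqVneq (neg kappa K) 0%E; first by right.
exfalso.
pose al := fine (pos kappa K); pose be := fine (neg kappa K).
have al0 : 0 < al.
  rewrite /al fine_gt0// lt_neqAle eq_sym pos0 measure_ge0/=.
  by have := fin_num_measure (pos kappa) _ mK; rewrite fin_numElt => /andP[].
have be0 : 0 < be.
  rewrite /be fine_gt0// lt_neqAle eq_sym neg0 measure_ge0/=.
  by have := fin_num_measure (neg kappa) _ mK; rewrite fin_numElt => /andP[].
(* These weights are at most [1] and give both restricted parts the common mass
   [al * be / (al + be)]. *)
have rr0 : 0 <= be / (al + be) by rewrite divr_ge0 ?addr_ge0 ?ltW.
have ss0 : 0 <= al / (al + be) by rewrite divr_ge0 ?addr_ge0 ?ltW.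
have posoo : (pos kappa K < +oo)%E.
  by have := fin_num_measure (pos kappa) _ mK; rewrite fin_numElt => /andP[].
have negoo : (neg kappa K < +oo)%E.
  by have := fin_num_measure (neg kappa) _ mK; rewrite fin_numElt => /andP[].
pose m1 : {finite_measure set R -> \bar R} := mscale (NngNum rr0) (mfrestr mK posoo).
pose m2 : {finite_measure set R -> \bar R} := mscale (NngNum ss0) (mfrestr mK negoo).
pose M := al * be / (al + be).
have M0 : 0 < M by rewrite divr_gt0 ?mulr_gt0 ?addr_gt0.
have m1E E : m1 E = ((be / (al + be))%:E * pos kappa (E `&` K))%E by [].
have m2E E : m2 E = ((al / (al + be))%:E * neg kappa (E `&` K))%E by [].
have m1K : m1 (~` K) = 0%E by rewrite m1E setICl measure0 mule0.
have m2K : m2 (~` K) = 0%E by rewrite m2E setICl measure0 mule0.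
have m1M E : K `<=` E -> fine (m1 E) = M.
  move=> KE; rewrite m1E (setIidr KE) -(fineK (fin_num_measure (pos kappa) _ mK)).
  by rewrite -EFinM /= -/al /M; ring.
have m2M E : K `<=` E -> fine (m2 E) = M.
  move=> KE; rewrite m2E (setIidr KE) -(fineK (fin_num_measure (neg kappa) _ mK)).
  by rewrite -EFinM /= -/be /M; ring.
have m1pos E : measurable E -> (m1 E <= pos kappa E)%E.
  move=> mE; rewrite m1E; apply: (@le_trans _ _ (1 * pos kappa (E `&` K))%E).
    apply: lee_wpmul2r => //; rewrite lee_fin ler_pdivrMr ?addr_gt0// mul1r.
    by rewrite lerDr ltW.
  by rewrite mul1e; apply: le_measure; rewrite ?inE//; exact: measurableI.
have m2neg E : measurable E -> (m2 E <= neg kappa E)%E.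
  move=> mE; rewrite m2E; apply: (@le_trans _ _ (1 * neg kappa (E `&` K))%E).
    apply: lee_wpmul2r => //; rewrite lee_fin ler_pdivrMr ?addr_gt0// mul1r.
    by rewrite lerDl ltW.
  by rewrite mul1e; apply: le_measure; rewrite ?inE//; exact: measurableI.
pose sigma := difference m1 m2.
have sigmaE E : measurable E -> sigma E = (m2 E - m1 E)%E.
  by move=> _; exact: differenceE.
pose h := primitive m1 m2.
have hi : mu.-integrable `]a, b[ (EFin \o h) by exact: primitive_integrable.
have Dh : is_D bc a b h sigma.
  by apply: (is_D_primitive ab mK Kab m1K m2K); rewrite m1M// m2M.
have Dz := is_D_add ab vi hi Dv Dh.
have tv (t : R) : is_D_tilt bc a b v t (tilt ab t nu) by exact: is_D_tilt_tilt.
have tz (t : R) := is_D_tilt_add ab vi hi (tv t) Dh.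
have BVz : BV bc a b (fun x => v x + h x).
  split; last by exists (cadd nu sigma).
  by have := integrableD _ vi hi; apply.
have := sel _ nu (cadd nu sigma) _ _ BVz Dv Dz
  (ex_intro _ _ (ex_intro _ _ (And3 (tv 1) (tv (-1)) erefl)))
  (ex_intro _ _ (ex_intro _ _ (And3 (tz 1) (tz (-1)) erefl))).
have [N N0 omN] := within_continuous_bounded ab comc.
have omND x : dom bc x -> `|omc x| <= N.
  by move=> /domain_sub; rewrite /= in_itv/=; exact: omN.
have mom : measurable_fun (dom bc) omc.
  by apply: within_continuous_measurable => //; exact: domain_sub.
(* The terms in [nu] cancel, and what remains of the duality term is concentrated on [K]. *)
have intE : charge_integral (cadd (cadd nu sigma) (cscale (-1) nu)) (dom bc) omc =
    \int[m2]_(x in K) omc x - \int[m1]_(x in K) omc x.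
  rewrite (@charge_integral_cadd _ _ _ _ _ N)// (@charge_integral_cadd _ _ _ _ _ N)//.
  rewrite (@charge_integral_cscale _ _ _ _ _ N)//.
  rewrite (@charge_integralE _ sigma m2 m1 _ _ N)//.
  rewrite (@Rintegral_concentrated _ _ _ m2 _ K _ N)//.
  by rewrite (@Rintegral_concentrated _ _ _ m1 _ K _ N)//; ring.
have oscK x : K x -> omc x0 - 1 / 2 <= omc x <= omc x0 + 1 / 2.
  rewrite /K/= in_itv/= => /osc; rewrite ler_norml => /andP[h1 h2].
  by apply/andP; split; lra.
have intK (m : {finite_measure set R -> \bar R}) : m.-integrable K (EFin \o omc).
  apply: (@bounded_integrable _ _ _ m _ _ N) => //.
    exact: (measurable_funS mD KD).
  by move=> x /KD; exact: omND.
have le1 : \int[m1]_(x in K) omc x <= (omc x0 + 1 / 2) * M.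
  rewrite -(m1M K)// -(Rintegral_cst m1 mK); apply: le_Rintegral => //.
  - exact: (intK m1).
  - exact: (finite_measure_integrable_cst m1).
  - by move=> x /oscK /andP[].
have le2 : (omc x0 - 1 / 2) * M <= \int[m2]_(x in K) omc x.
  rewrite -(m2M K)// -(Rintegral_cst m2 mK); apply: le_Rintegral => //.
  - exact: (finite_measure_integrable_cst m2).
  - exact: (intK m2).
  - by move=> x /oscK /andP[].
rewrite intE.
(* The variation of [kappa] drops by [2 M]. The other tilt is below [kappa] for [d = 1], so its
   negative part still dominates [m2]; for [d = -1] it is above, and its positive part dominates
   [m1]. In either case the gain and the loss of [M] balance. *)
have tvle : fine (total_var (cadd (tilt ab 1 nu) sigma) (dom bc)) +
    fine (total_var (cadd (tilt ab (-1) nu) sigma) (dom bc)) <=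
    fine (total_var (tilt ab 1 nu) (dom bc)) +
    fine (total_var (tilt ab (-1) nu) (dom bc)) - 2 * M.
  have lt11 : -1 <= 1 :> R by lra.
  have both := total_var_perturb_both mD sigmaE m1pos m2neg.
  rewrite (m1M _ KD) (m2M _ KD) in both.
  have arith (X X' Y Y' : R) : X' <= X - M - M -> Y' <= Y + M - M ->
    X' + Y' <= X + Y - 2 * M by lra.
  have arith' (X X' Y Y' : R) : X' <= X - M + M -> Y' <= Y - M - M ->
    X' + Y' <= X + Y - 2 * M by lra.
  case: d1 => dE.
  - have le E : measurable E -> (m2 E <= neg (tilt ab (-1) nu) E)%E.
      move=> mE; apply: (le_trans (m2neg _ mE)).
      apply: jordan_neg_mono => // E' mE'; rewrite /kappa dE.
      exact: tilt_le.
    have other := total_var_perturb_neg mD sigmaE le.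
    rewrite (m1M _ KD) (m2M _ KD) in other; rewrite /kappa dE in both.
    exact: arith both other.
  - have le E : measurable E -> (m1 E <= pos (tilt ab 1 nu) E)%E.
      move=> mE; apply: (le_trans (m1pos _ mE)).
      apply: jordan_pos_mono => // E' mE'; rewrite /kappa dE.
      exact: tilt_le.
    have other := total_var_perturb_pos mD sigmaE le.
    rewrite (m1M _ KD) (m2M _ KD) in other; rewrite /kappa dE in both.
    exact: arith' other both.
rewrite -(fineK (total_var_fin (tilt ab 1 nu) mD)).
rewrite -(fineK (total_var_fin (tilt ab (-1) nu) mD)).
rewrite -(fineK (total_var_fin (cadd (tilt ab 1 nu) sigma) mD)).
rewrite -(fineK (total_var_fin (cadd (tilt ab (-1) nu) sigma) mD)).
(* The selection inequality now reads [I2 - I1 <= - 2 M], while the oscillation bound gives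
   [I2 - I1 >= - M]. *)
rewrite -!EFinD lee_fin => Wle; have := le_trans Wle tvle.
rewrite -!addrA !lerD2l; move: le1 le2.
move: (\int[m1]_(x in K) omc x) (\int[m2]_(x in K) omc x) => I1 I2.
by move: M0; clearbody M; rewrite mulrDl mulrBl; clear; lra.
Qed.

End Variation.

(** * Detecting one-sided slopes with bump functions *)

Section Slopes.
Context (R : realType) (a b : R).
Hypothesis ab : a < b.
Local Notation mu := (@lebesgue_measure R).
Local Notation pos nu := (jordan_pos (hahn_posnegP nu)).
Local Notation neg nu := (jordan_neg (hahn_posnegP nu)).
Local Notation dom bc := (domain bc a b).

Lemma Rintegral_indic_cc (C al be : R) : al <= be -> a < al -> be < b ->
  \int[mu]_(x in `]a, b[) (C * \1_(`[al, be]) x) = C * (be - al).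
Proof.
move=> albe aal beb.
have abJ : `]a, b[%classic `&` `[al, be]%classic = `[al, be]%classic.
  apply/setIidr => x; rewrite /= !in_itv/= => /andP[h1 h2]; apply/andP; split; lra.
have ii : mu.-integrable `]a, b[ (EFin \o \1_(`[al, be])).
  apply: (@measurable_bounded_integrable _ _ _ mu) => //.
  - exact: lebesgue_oo_lty.
  exists 1; split; first exact: num_real.
  move=> y /ltW y1 x _; apply: le_trans y1; rewrite indicE.
  by case: (_ \in _); rewrite ?normr1 ?normr0.
rewrite RintegralZl//; congr (_ * _).
rewrite /Rintegral integral_indic// setIC abJ.
transitivity (fine (mu `[al, be]%classic)) => //.
rewrite lebesgue_measure_itv/= lte_fin.
case: ltP => [//|beal]; by rewrite /=; lra.
Qed.

Lemma integrable_indic_cc (C al be : R) :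
  mu.-integrable `]a, b[ (EFin \o (fun x => C * \1_(`[al, be]) x)).
Proof.
apply: (@measurable_bounded_integrable _ _ _ mu) => //.
- exact: lebesgue_oo_lty.
- apply: measurable_funM; first exact: measurable_cst.
  exact: measurable_indic.
exists `|C|; split; first exact: num_real.
move=> y /ltW y1 x _; apply: le_trans y1; rewrite indicE.
by case: (_ \in _); rewrite ?mulr1// mulr0 normr0.
Qed.

(** The bound is only almost everywhere because one-sided derivatives are those of some
    representative of [v]. *)
Lemma Rintegral_ae_bound (g : R -> R) (C al be : R) :
  al <= be -> a < al -> be < b -> 0 <= C ->
  mu.-integrable `]a, b[ (EFin \o g) ->
  {ae mu, forall x, a < x < b -> `|g x| <= C * \1_(`[al, be]) x} ->
  `| \int[mu]_(x in `]a, b[) g x | <= C * (be - al).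
Proof.
move=> albe aal beb C0 gi gC.
rewrite -lee_fin EFin_normr_Rintegral//.
apply: (le_trans (le_abse_integral _ _ (measurable_int _ gi))) => //.
rewrite -(Rintegral_indic_cc C albe aal beb) /Rintegral fineK; last first.
  by apply: integrable_fin_num => //; exact: integrable_indic_cc.
apply: ae_ge0_le_integral => //.
- by apply: measurableT_comp => //; exact: measurable_int gi.
- by move=> x _; rewrite lee_fin mulr_ge0.
- exact: measurable_int (integrable_indic_cc C al be).
Qed.

(* The right derivative for [s = 1], the left one for [s = -1]; [l] is the
   one-sided limit. *)
Definition one_sided_slope (s : R) (w : R -> R) (x0 l p : R) :=
  forall e, 0 < e -> exists2 r, 0 < r &
    forall y, 0 < y < r -> `|w (x0 + s * y) - l - p * (s * y)| <= e * y.

Lemma right_deriv_slope v x0 p : right_deriv a b v x0 p ->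
  exists w l, ae_eq_on a b w v /\ one_sided_slope 1 w x0 l p.
Proof.
move=> [w [l [wv _ cw]]]; exists w, l; split => // e e0.
have /cvgrPdist_lt/(_ _ e0)/nbhs_ballP[r /= r0 h] := cw.
exists r => // y /andP[y0 yr].
have {h} := h (x0 + y); rewrite /ball/= ltrDl opprD addNKr normrN gtr0_norm//.
move=> /(_ yr y0); rewrite [x0 + y - x0]addrC addKr => /ltW h.
rewrite !mul1r distrC.
have -> : p * y - (w (x0 + y) - l) = (p - (w (x0 + y) - l) / y) * y.
  by field; rewrite gt_eqF.
by rewrite normrM [`|y|]gtr0_norm// ler_pM2r.
Qed.

Lemma left_deriv_slope v x0 p : left_deriv a b v x0 p ->
  exists w l, ae_eq_on a b w v /\ one_sided_slope (-1) w x0 l p.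
Proof.
move=> [w [l [wv _ cw]]]; exists w, l; split => // e e0.
have /cvgrPdist_lt/(_ _ e0)/nbhs_ballP[r /= r0 h] := cw.
exists r => // y /andP[y0 yr].
have {h} := h (x0 - y); rewrite /ball/= ltrBlDr ltrDl opprB addrC subrK gtr0_norm//.
move=> /(_ yr y0); rewrite [x0 - y - x0]addrC addKr => /ltW h.
rewrite !mulN1r distrC.
have -> : p * - y - (w (x0 - y) - l) = (p - (w (x0 - y) - l) / - y) * - y.
  by field; rewrite gt_eqF.
by rewrite normrM normrN [`|y|]gtr0_norm// ler_pM2r.
Qed.

Section BumpAt.
Variables (x0 s t : R).
Hypotheses (s1 : s = 1 \/ s = -1) (t0 : 0 < t).

Let st0 : s * t != 0.
Proof.
rewrite mulf_neq0 ?(gt_eqF t0)//.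
by case: s1 => ->; rewrite ?oppr_eq0 oner_neq0.
Qed.

Let arg x : (s * t)^-1 * x + - ((s * t)^-1 * x0) = s * (x - x0) / t.
Proof. by case: s1 st0 => ->; rewrite ?mulN1r ?mul1r => h; field; rewrite gt_eqF. Qed.

Lemma bump_atE x : bump_at x0 (s * t) x = bump (s * (x - x0) / t).
Proof. by rewrite /bump_at arg. Qed.

Lemma smooth_bump_at : smooth (bump_at x0 (s * t)).
Proof. exact: smooth_affine (@smooth_bump R). Qed.

Lemma derive1_bump_at x :
  derive1 (bump_at x0 (s * t)) x = (s * t)^-1 * derive1 (@bump R) (s * (x - x0) / t).
Proof.
rewrite derive1E -arg.
by have [_ ->] := derive1_affine ((@smooth_bump R : smooth (@bump R)) 0%N
  ((s * t)^-1 * x + - ((s * t)^-1 * x0))).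
Qed.

Lemma bump_at_support x : bump_at x0 (s * t) x != 0 -> t <= s * (x - x0) <= 2 * t.
Proof.
by rewrite bump_atE => /bump_support; rewrite ler_pdivlMr// ler_pdivrMr// mul1r.
Qed.

Lemma derive1_bump_at_support x : derive1 (bump_at x0 (s * t)) x != 0 ->
  t <= s * (x - x0) <= 2 * t.
Proof.
rewrite derive1_bump_at mulf_eq0 negb_or => /andP[_].
move=> /(derive1_vanishes_outside (@bump_support R)).
by rewrite ler_pdivlMr// ler_pdivrMr// mul1r.
Qed.

Lemma derive1_bump_at_le K x : (forall y, `|derive1 (@bump R) y| <= K) ->
  `|derive1 (bump_at x0 (s * t)) x| <= K / t.
Proof.
move=> h; rewrite derive1_bump_at normrM normfV normrM (gtr0_norm t0).
have -> : `|s| = 1 by case: s1 => ->; rewrite ?normrN normr1.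
by rewrite mul1r mulrC ler_pM2r// invr_gt0.
Qed.

End BumpAt.

(** The centre [x0 + s * (3/2 * t)] is the midpoint of the support of the bump. Half-width [t/2]
    gives the whole support, [t/6] its middle third. *)
Lemma bump_interval (x0 s t r k : R) : s = 1 \/ s = -1 -> 0 < t -> 4 * t <= r ->
  0 <= k <= t / 2 -> a < x0 - r -> x0 + r < b ->
  [/\ x0 + s * (3 / 2 * t) - k <= x0 + s * (3 / 2 * t) + k,
    a < x0 + s * (3 / 2 * t) - k & x0 + s * (3 / 2 * t) + k < b].
Proof. by case=> -> t0 tr /andP[k0 kt] ar rb; split; lra. Qed.

Lemma bump_intervalE (x0 s t k x : R) : s = 1 \/ s = -1 ->
  (x0 + s * (3 / 2 * t) - k <= x <= x0 + s * (3 / 2 * t) + k) =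
  (3 / 2 * t - k <= s * (x - x0) <= 3 / 2 * t + k).
Proof. by case=> ->; apply/andP/andP => -[h1 h2]; split; lra. Qed.

(** Replacing [v] by its affine approximation [l + p (x - x0)] turns the integral into [(p + d)]
    times that of the bump, which is of order [t]. The remainder is small against [t]: it is at most
    [2 e t] times a derivative of order [1 / t] on an interval of length [t]. *)
Lemma test_detects_slope bc (v w : R -> R) nu (d x0 l p s r : R) :
  s = 1 \/ s = -1 -> 0 < r -> a < x0 - r -> x0 + r < b ->
  mu.-integrable `]a, b[ (EFin \o v) -> is_D bc a b v nu ->
  ae_eq_on a b w v -> one_sided_slope s w x0 l p -> p + d != 0 ->
  exists phi, [/\ test bc a b phi,
    forall x, dom bc x -> 0 <= phi x,
    forall x, dom bc x -> ~ `[x0 - r, x0 + r]%classic x -> phi x = 0 &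
    0 < (p + d) * charge_integral (tilt ab d nu) (dom bc) phi].
Proof.
move=> s1 r0 ar rb vi Dv wv slope q0.
have [m m0 bumpm] := bump_lower R.
have [K K0 bumpK] := derive1_bump_bounded R.
set q := p + d in q0 *; have nq0 : 0 < `|q| by rewrite normr_gt0.
(* With this [e] the remainder bound [2 * e * K * t] is [|q| m t / 6], half of the lower bound
   [|q| m t / 3] of the main term. *)
pose e := `|q| * m / (12 * K).
have e0 : 0 < e by rewrite divr_gt0 ?mulr_gt0.
have [r1 r10 wslope] := slope e e0.
pose t := Num.min r r1 / 4.
have t0 : 0 < t by rewrite divr_gt0// lt_min r0.
have tr : 4 * t <= r by rewrite /t mulrC divfK// ge_min lexx.
have tr1 : 4 * t <= r1 by rewrite /t mulrC divfK// ge_min lexx orbT.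
pose f := bump_at x0 (s * t).
have sf : smooth f by exact: smooth_bump_at.
have fx x : f x != 0 -> x0 - r <= x <= x0 + r.
  move=> /(bump_at_support s1 t0) /andP[]; case: s1 => -> h1 h2.
    by apply/andP; split; lra.
  by apply/andP; split; lra.
have Cf : Ccinfty a b f by split=> //; exists (x0 - r), (x0 + r).
have [phi [tphi phif dphif]] := test_extension ab bc Cf.
have phiD x : dom bc x -> phi x = f x.
  move=> Dx; apply: phif; move: Dx.
  by case: (bc) => [|A B|]; rewrite /domain/= in_itv/= => /andP[h1 h2];
    rewrite ?h2 ?h1// ltW.
exists phi; split => //.
- by move=> x /phiD ->; exact: bump_ge0.
- move=> x /phiD -> xK; apply/eqP/negPn/negP => /fx xr; apply: xK.
  by rewrite /= in_itv/=.
have cf : continuous f by exact: smooth_continuous.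
have cdf : continuous (derive1 f) by apply: smooth_continuous; exact: smooth_derive1.
have vfi := integrable_mul_continuous ab vi cdf.
have xfi := integrable_mul_continuous ab (id_integrable a b) cdf.
have fi := @continuous_integrable R a b f cf.
have dfi := @continuous_integrable R a b _ cdf.
have [fa fb] := Ccinfty_ends Cf.
have Ixf := Rintegral_id_derive1 ab sf; rewrite fa fb !mulr0 subr0 sub0r in Ixf.
have Idf := Rintegral_derive1 ab sf; rewrite fa fb subr0 in Idf.
(* The constant [l] contributes nothing, since [f] vanishes at both ends; the linear term
   contributes [p] times the integral of [f]. *)
pose g x := (v x - l - p * (x - x0)) * derive1 f x.
have ilx : mu.-integrable `]a, b[ (EFin \o (fun x => l + p * (x - x0))).
  apply: continuous_integrable => // x; apply: cvgD; first exact: cvg_cst.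
  apply: cvgM; first exact: cvg_cst.
  by apply: cvgB; [exact: cvg_id|exact: cvg_cst].
have vlx : mu.-integrable `]a, b[ (EFin \o (fun x => v x - (l + p * (x - x0)))).
  by have := integrableB _ vi ilx; apply.
have gi : mu.-integrable `]a, b[ (EFin \o g).
  have := integrable_mul_continuous ab vlx cdf; congr (_.-integrable _ _).
  by apply/funext => x /=; congr EFin; rewrite /g; ring.
have Ig : \int[mu]_(x in `]a, b[) g x =
    \int[mu]_(x in `]a, b[) (v x * derive1 f x) + p * \int[mu]_(x in `]a, b[) f x.
  transitivity (\int[mu]_(x in `]a, b[) (v x * derive1 f x -
      ((l - p * x0) * derive1 f x + p * (x * derive1 f x)))).
    by apply: eq_Rintegral => x _; rewrite /g; ring.
  have i1 : mu.-integrable `]a, b[ (EFin \o (fun x => (l - p * x0) * derive1 f x)).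
    exact: (integrableZl _ (l - p * x0) dfi).
  have i2 : mu.-integrable `]a, b[ (EFin \o (fun x => p * (x * derive1 f x))).
    exact: (integrableZl _ p xfi).
  rewrite RintegralB//; last by have := integrableD _ i1 i2; apply.
  by rewrite RintegralD// !RintegralZl// Idf Ixf; ring.
have chE : charge_integral (tilt ab d nu) (dom bc) phi =
    q * \int[mu]_(x in `]a, b[) f x - \int[mu]_(x in `]a, b[) g x.
  rewrite charge_integral_tilt// Ig.
  have -> : charge_integral nu (dom bc) phi =
      - \int[mu]_(x in `]a, b[) (v x * derive1 f x).
    transitivity (- \int[mu]_(x in `]a, b[) (v x * derive1 phi x)).
      by rewrite (Dv phi tphi) opprK.
    apply/eqP; rewrite eqr_opp; apply/eqP/eq_Rintegral => x.
    by rewrite inE/= in_itv/= => /dphif ->.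
  have -> : \int[mu]_(x in `]a, b[) phi x = \int[mu]_(x in `]a, b[) f x.
    by apply: eq_Rintegral => x; rewrite inE => /sub_domain /phiD ->.
  by rewrite /q; ring.
have fge : m * (t / 3) <= \int[mu]_(x in `]a, b[) f x.
  have k6 : 0 <= t / 6 <= t / 2 by move: t0; clear; lra.
  have [albe aal beb] := bump_interval s1 t0 tr k6 ar rb.
  have beal (c : R) : c + t / 6 - (c - t / 6) = t / 3 by clear; lra.
  rewrite -(beal (x0 + s * (3 / 2 * t))) -(Rintegral_indic_cc m albe aal beb).
  apply: le_Rintegral => //; first exact: integrable_indic_cc.
  move=> x _; rewrite indicE; have [xJ|_] := boolP (x \in _); last first.
    by rewrite mulr0; exact: bump_ge0.
  rewrite mulr1 /f bump_atE//; apply: bumpm.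
  move: xJ; rewrite inE/= in_itv/= bump_intervalE// => /andP[].
  rewrite ler_pdivlMr// ler_pdivrMr//; move: (s * (x - x0)) => y h1 h2.
  by apply/andP; move: h1 h2; clear; split; lra.
have gle : `|\int[mu]_(x in `]a, b[) g x| <= 2 * e * K * t.
  have k2 : 0 <= t / 2 <= t / 2 by move: t0; clear; lra.
  have [albe aal beb] := bump_interval s1 t0 tr k2 ar rb.
  have beal (c : R) : c + t / 2 - (c - t / 2) = t by clear; lra.
  have C0 : 0 <= 2 * e * K.
    by apply: mulr_ge0; [apply: mulr_ge0; [by []|exact: ltW]|exact: ltW].
  have := Rintegral_ae_bound albe aal beb C0 gi; rewrite beal; apply.
  (* The exceptional null set is the one where [w] and [v] may differ. *)
  case: wv => N [mN N0 wvN]; exists N; split => // x nx; apply: wvN => wvx.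
  apply: nx => xab.
  have [dfx|dfx] := eqVneq (derive1 f x) 0.
    by rewrite /g dfx mulr0 normr0 mulr_ge0.
  have /andP[h1 h2] := derive1_bump_at_support s1 t0 dfx.
  have ss : s * s = 1 by case: s1 => ->; ring.
  have xE : x0 + s * (s * (x - x0)) = x by rewrite mulrA ss; ring.
  rewrite indicE mem_set ?mulr1; last first.
    rewrite /= in_itv/= bump_intervalE//.
    by apply/andP; move: h1 h2; clear; move: (s * _) => y h1 h2; split; lra.
  rewrite /g normrM -(wvx xab).
  have := wslope (s * (x - x0)); rewrite xE (mulrA s s) ss mul1r => wle.
  have : `|w x - l - p * (x - x0)| <= e * (2 * t).
    apply: (le_trans (wle _)); last by rewrite ler_pM2l.
    by apply/andP; move: t0 tr1 h1 h2; clear; move: (s * _) => y *; split; lra.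
  move=> /ler_pM/(_ (derive1_bump_at_le x0 s1 t0 x bumpK)).
  rewrite !normr_ge0 => /(_ isT isT)/le_trans; apply.
  have -> // : e * (2 * t) * (K / t) = 2 * e * K by field; rewrite gt_eqF.
have eK : 2 * e * K * t = `|q| * (m * (t / 6)) by rewrite /e; field; rewrite gt_eqF.
rewrite eK in gle; rewrite chE mulrBr mulrA -expr2 -real_normK ?num_real// subr_gt0.
apply: (le_lt_trans (ler_norm _)); rewrite normrM expr2 -mulrA ltr_pM2l//.
apply: (le_lt_trans gle); rewrite ltr_pM2l//.
apply: lt_le_trans fge; rewrite ltr_pM2l//; lra.
Qed.

(** If the Jordan part in question were null on the interval, the tilt would integrate the
    nonnegative test function with the wrong sign. *)
Lemma charge_part_neq0 bc v w nu (d x0 l p s r : R) :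
  s = 1 \/ s = -1 -> 0 < r -> a < x0 - r -> x0 + r < b ->
  mu.-integrable `]a, b[ (EFin \o v) -> is_D bc a b v nu ->
  ae_eq_on a b w v -> one_sided_slope s w x0 l p ->
  (0 < p + d -> pos (tilt ab d nu) `[x0 - r, x0 + r] <> 0%E) /\
  (p + d < 0 -> neg (tilt ab d nu) `[x0 - r, x0 + r] <> 0%E).
Proof.
move=> s1 r0 ar rb vi Dv wv slope.
have mK : measurable `[x0 - r, x0 + r]%classic by exact: measurable_itv.
have mD := measurable_domain a b bc.
have null (m : {finite_measure set R -> \bar R}) phi : test bc a b phi ->
    m `[x0 - r, x0 + r]%classic = 0%E ->
    (forall x, dom bc x -> ~ `[x0 - r, x0 + r]%classic x -> phi x = 0) ->
    \int[m]_(x in dom bc) phi x = 0.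
  move=> tphi m0 phi0; have [M _ phiM] := test_bounded ab tphi.
  rewrite /Rintegral (negligible_integral mK mD _ m0); last first.
    by apply: bounded_integrable phiM => //; exact: test_measurable.
  by rewrite integral0_eq// => x [Dx /phi0 ->].
split=> q0 part0.
- have [] := test_detects_slope (d := d) s1 r0 ar rb vi Dv wv slope _.
    by rewrite gt_eqF.
  move=> phi [tphi phi_ge0 phi0]; rewrite pmulr_rgt0// /charge_integral.
  rewrite (null _ _ tphi part0 phi0) sub0r oppr_gt0 ltNge.
  by rewrite Rintegral_ge0// => x /phi_ge0.
- have [] := test_detects_slope (d := d) s1 r0 ar rb vi Dv wv slope _.
    by rewrite lt_eqF.
  move=> phi [tphi phi_ge0 phi0]; rewrite nmulr_rgt0// /charge_integral.
  rewrite (null _ _ tphi part0 phi0) subr0 ltNge.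
  by rewrite Rintegral_ge0// => x /phi_ge0.
Qed.

(** The sign [s] names the side of the smaller slope, so both orders are treated at once. The two
    sides may use different representatives of [v]. *)
Lemma slopes_not_separated bc v om x0 (c s : R) w1 l1 p1 w2 l2 p2 :
  a < x0 < b -> c = 1 \/ c = -1 -> s = 1 \/ s = -1 ->
  BV bc a b v -> is_selection bc a b v om ->
  ae_eq_on a b w1 v -> one_sided_slope s w1 x0 l1 p1 ->
  ae_eq_on a b w2 v -> one_sided_slope (- s) w2 x0 l2 p2 ->
  p1 < c -> c < p2 -> False.
Proof.
move=> x0ab c1 s1 [vi [nu Dv]] sel wv1 slope1 wv2 slope2 p1c cp2.
have d1 : - c = 1 \/ - c = -1 by case: c1 => ->; [right|left; rewrite opprK].
have s1' : - s = 1 \/ - s = -1 by case: s1 => ->; [right|left; rewrite opprK].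
have [r [r0 ar rb []]] := no_sign_change ab x0ab d1 vi Dv sel.
  by apply: (charge_part_neq0 (-c) s1' r0 ar rb vi Dv wv2 slope2).1; rewrite subr_gt0.
by apply: (charge_part_neq0 (-c) s1 r0 ar rb vi Dv wv1 slope1).2; rewrite subr_lt0.
Qed.

End Slopes.

Theorem theorem4p2 (R : realType) (a b T : R) (hab : a < b) (hT : 0 < T)
  (bc : bdry_cond R) (u ut Om : R -> R -> R)
  (hsol : is_solution bc a b T u ut Om)
  (t : R) (ht : typical_time bc a b T u ut Om t)
  (x0 : R) (hx0 : a < x0 < b) (pm pp : R)
  (hpm : left_deriv a b (u t) x0 pm) (hpp : right_deriv a b (u t) x0 pp) :
  (pm < pp -> `]pm, pp[ `&` [set -1; 1] = set0) /\
  (pp < pm -> `]pp, pm[ `&` [set -1; 1] = set0).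
Proof.
have [_ [bv _ sel _] _ _] := ht.
have [wr [lr [wrv slr]]] := right_deriv_slope hpp.
have [wl [ll [wlv sll]]] := left_deriv_slope hpm.
have s1 : -1 = 1 :> R \/ -1 = -1 :> R by right.
have s1' : 1 = 1 :> R \/ 1 = -1 :> R by left.
have sr : one_sided_slope (- -1) wr x0 lr pp by rewrite opprK.
(* The smaller slope is on the left in the first claim ([s = -1]) and on the right in the second
   ([s = 1]). *)
split=> _; rewrite -subset0 => c /= []; rewrite in_itv/= => /andP[h1 h2] c11;
  have c1 : c = 1 \/ c = -1 by case: c11 => ->; [right|left].
- exact: (slopes_not_separated hab hx0 c1 s1 bv sel wlv sll wrv sr h1 h2).
- exact: (slopes_not_separated hab hx0 c1 s1' bv sel wrv slr wlv sll h1 h2).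
Qed.
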